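(* Let $G$ be a Lie group of dimension $r$ acting smoothly, freely and regularly on (an open domain of) the jet space $M$ with a single independent variable $s$ and dependent variables $u^1,\dots,u^q$, by a prolonged action leaving $s$ unchanged, and let $\rho$ be a right moving frame. Suppose that the Lie algebra $\mathcal{X}_G(M)$ of infinitesimal vector fields generating the transformation group $G$ is semisimple, and let $\mathbf{B}$ be the (matrix of the) Killing form of $\mathcal{X}_G(M)$. Let $L(\kappa^\alpha,\kappa^\alpha_s,\dots)\,\mathrm{d}s$ be a Lagrangian invariant under the action of $G$, where the $\kappa^\alpha$ are generating differential invariants. Then $$\boldsymbol{\upsilon}(I)^T\mathbf{B}^{-1}\boldsymbol{\upsilon}(I)=\mathbf{c}^T\mathbf{B}^{-1}\mathbf{c}$$ is a first integral for the Euler--Lagrange equations $\mathsf{E}^\alpha(L)=0$, $\alpha=1,\dots,q$, where $\boldsymbol{\upsilon}(I)=\sum_\alpha\Omega^\alpha(I)\,\mathcal{C}^\alpha$ is the vector of invariants appearing in Noether's first integrals $\mathcal{A}d(\rho)^{-1}\boldsymbol{\upsilon}(I)=\mathbf{c}$ and $\mathbf{c}$ is the constant vector of these first integrals.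
   Context: Jet notation. Coordinates on $M$ are $s$, $u^\alpha$ and derivatives $u^\alpha_J$ of $u^\alpha$ with respect to $s$ (finite order). The action of $G$ on jets is the prolonged one (induced by the chain rule); write $\widetilde z=g\cdot z$. Moving frame. The action is assumed free and regular on a domain $\mathcal{U}\subset M$: group orbits meeting $\mathcal{U}$ have dimension $r$ and foliate $\mathcal{U}$; there is a surface $\mathcal{K}\subset\mathcal{U}$ (cross-section) of dimension $\dim M-r$ meeting each orbit transversally in exactly one point; and the group element taking $z\in\mathcal{U}$ to the point of $\mathcal{O}(z)\cap\mathcal{K}$ is unique, where $\mathcal{O}(z)$ is the orbit of $z$. The right moving frame $\rho:\mathcal{U}\to G$ is defined by $\rho(z)\cdot z\in\mathcal{K}$. Invariantisation is $I(z)=\rho(z)\cdot z$; $I(u^\alpha_J)=\widetilde{u^\alpha_J}|_{g=\rho(z)}$. Since $s$ is invariant, $\mathcal{D}_s=D/Ds$ (the total derivative) is the invariant differential operator. The generating differential invariants $\kappa^\alpha$ are taken among the $I(u^\beta_J)$; all differential invariants are functions of $s$, the $\kappa^\alpha$ and their $s$-derivatives. Variation and the coefficients $\mathcal{C}^\alpha$. Introduce an additional independent variable $\tau$, invariant under $G$, with $u^\alpha=u^\alpha(s,\tau)$; the frame is unchanged. Set $I^\alpha_{\tau J}=I(u^\alpha_{\tau J})=\widetilde{u^\alpha_{\tau J}}|_{g=\rho(z)}$, where $J$ is a (possibly empty) index of differentiation with respect to $s$. There are syzygies $\mathcal{D}_\tau\kappa^j=\sum_\alpha\mathcal{H}_{j,\alpha}I^\alpha_\tau$,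 where the $\mathcal{H}_{j,\alpha}$ are linear differential operators in $\mathcal{D}_s$ with coefficients depending only on the $\kappa$'s and their derivatives. Writing $\mathcal{D}_\tau L=\sum_{j,k}\frac{\partial L}{\partial\mathcal{D}_s^k\kappa^j}\mathcal{D}_s^k\mathcal{D}_\tau\kappa^j$, integrating by parts, substituting the syzygies and integrating by parts again gives $$\mathcal{D}_\tau L=\sum_\alpha\mathsf{E}^\alpha(L)I^\alpha_\tau+\frac{D}{Ds}P,\qquad P=\sum_{\alpha,J}I^\alpha_{\tau J}\,C^\alpha_J,$$ where $\mathsf{E}^\alpha(L)=\sum_j\mathcal{H}^*_{j,\alpha}\Big(\sum_k(-1)^k\mathcal{D}_s^k\frac{\partial L}{\partial\mathcal{D}_s^k\kappa^j}\Big)$ are the invariantised Euler--Lagrange expressions ($\mathcal{H}^*_{j,\alpha}$ the formal adjoint) and the coefficients $C^\alpha_J$ are differential invariants. Put $\mathcal{C}^\alpha=(C^\alpha_J)_J$ (a column vector). Infinitesimals. Let $(a_1,\dots,a_r)$ be coordinates of $G$ near the identity $e$, with associated infinitesimal vector fields $\mathbf{v}_1,\dots,\mathbf{v}_r$ forming a basis of $\mathcal{X}_G(M)$; $\mathbf{v}_j$ has component $\frac{\partial\widetilde z}{\partial a_j}\big|_{g=e}$ along each coordinate $z$ of $M$. The matrix $\Omega^\alpha(z)$ has rows indexed by $j=1,\dots,r$ and columns indexed by $J$, with entries $\frac{\partial\widetilde{u^\alpha_J}}{\partial a_j}\big|_{g=e}$; $\Omega^\alpha(I)$ is obtained by replacing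 each coordinate $z$ in the entries by $I(z)$. Adjoint representation. $Ad_g(\mathbf{v})(z)=Tg^{-1}\,\mathbf{v}(g\cdot z)$, i.e. if $\mathbf{v}=\sum_jf_j(z)\partial_{z_j}$ then $Ad_g(\mathbf{v})$ has coefficient vector $\left(\frac{\partial\widetilde z}{\partial z}\right)^{-1}\mathbf{f}(\widetilde z)$. $\mathcal{A}d(g)$ is the $r\times r$ matrix with $Ad_g(\mathbf{v}_i)=\sum_j\mathcal{A}d(g)^i_j\,\mathbf{v}_j$ ($i$ the row index), and $\mathcal{A}d(\rho)$ is its evaluation at $g=\rho(z)$. Noether's first integrals. The $j$-th one is $P=c_j$ on solutions of the Euler--Lagrange equations, with the variation $u^\alpha_{\tau J}$ in $P$ replaced by $\frac{\partial\widetilde{u^\alpha_J}}{\partial a_j}\big|_{g=e}$. In vector form, with $\mathbf{c}=(c_1,\dots,c_r)^T$, these are $\mathcal{A}d(\rho)^{-1}\boldsymbol{\upsilon}(I)=\mathbf{c}$ with $\boldsymbol{\upsilon}(I)=\sum_\alpha\Omega^\alpha(I)\mathcal{C}^\alpha$. Killing form. For $\mathbf{v}\in\mathcal{X}_G(M)$, $\mathrm{ad}_{\mathbf{v}}(\mathbf{w})=[\mathbf{v},\mathbf{w}]$ (bracket of vector fields). The Killing form is $B(\mathbf{v},\mathbf{w})=\mathrm{trace}(\mathrm{ad}_{\mathbf{v}}\,\mathrm{ad}_{\mathbf{w}})$ and $\mathbf{B}=(B_{ij})$, $B_{ij}=B(\mathbf{v}_i,\mathbf{v}_j)$, in the same basis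 used for $\mathcal{A}d(g)$ and $\Omega^\alpha$. Semisimplicity means that $\mathbf{B}$ is invertible. *)

(* Defs.v *)
From HB Require Import structures.
From mathcomp Require Import all_boot all_order all_algebra.
From mathcomp Require Import all_classical all_reals all_analysis.

Set Implicit Arguments.
Unset Strict Implicit.
Unset Printing Implicit Defensive.

Import Order.TTheory GRing.Theory Num.Theory.
Import numFieldNormedType.Exports.

Local Open Scope ring_scope.
Local Open Scope classical_set_scope.

Section Smoothness.
Context {R : realType} {V W : normedModType R}.

Fixpoint differentiable_upto (k : nat) (A : set V) (f : V -> W) : Prop :=
  if k is k'.+1 then
    (forall x, A x -> differentiable f x) /\
    (forall v : V, differentiable_upto k' A (fun x => 'D_v f x))
  else True.

(* C^oo on A; it is only ever used with A open *)
Definition smooth_on (A : set V) (f : V -> W) : Prop :=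
  forall k, differentiable_upto k A f.

End Smoothness.

(* An r-dimensional Lie group structure on the abstract group G.  The atlas is
   indexed by nat, which is second countability; a set O is open for the
   manifold topology iff [coord i @` (dom i `&` O)] is open for every i. *)
Record lieGroup (R : realType) (G : groupType) (r : nat) := LieGroup {
  dom : nat -> set G ;
  coord : nat -> G -> 'rV[R]_r ;
  param : nat -> 'rV[R]_r -> G ;
  dom_cover : forall g, exists i, dom i g ;
  coordK : forall i g, dom i g -> param i (coord i g) = g ;
  overlap_open : forall i j, open (coord i @` (dom i `&` dom j)) ;
  transition_smooth : forall i j,
    smooth_on (coord i @` (dom i `&` dom j)) (fun x => coord j (param i x)) ;
  lie_hausdorff : forall g h : G, g != h -> exists A B : set G,
    [/\ A g, B h, A `&` B = set0 &
     forall i, open (coord i @` (dom i `&` A)) /\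
               open (coord i @` (dom i `&` B))] ;
  mul_smooth : forall i j k,
    let A := [set xy : 'rV[R]_r * 'rV[R]_r |
      [/\ (coord i @` dom i) xy.1, (coord j @` dom j) xy.2 &
          dom k (param i xy.1 * param j xy.2)%g]] in
    open A /\
    smooth_on A (fun xy => coord k (param i xy.1 * param j xy.2)%g) ;
  inv_smooth : forall i k,
    let A := [set x | (coord i @` dom i) x /\ dom k (param i x)^-1%g] in
    open A /\ smooth_on A (fun x => coord k (param i x)^-1%g)
}.

(* A point z of the jet space of order n: z.1 is s, and z.2 alpha k is the
   k-th s-derivative of u^alpha.  With one independent variable the
   multi-index J is its length k. *)
Notation jetSpace R q n := (R * 'M[R]_(q, n.+1))%type.

Section Setting.
Context {R : realType} {q n : nat}.
Notation M := (jetSpace R q n).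

Definition jet (u : R -> 'cV[R]_q) (s : R) : M :=
  (s, \matrix_(a, k) derive1n k (fun t => u t a ord0) s).

Definition order0 (z : M) : 'cV[R]_q := col ord0 z.2.

Definition curve_in (U : set M) (A : set R) (u : R -> 'cV[R]_q) : Prop :=
  [/\ open A, smooth_on A u & forall s, A s -> U (jet u s)].

(* u(s, tau) *)
Definition slice (u : R * R -> 'cV[R]_q) (tau : R) : R -> 'cV[R]_q :=
  fun s => u (s, tau).

Definition variation_in (U : set M) (W : set (R * R)) (u : R * R -> 'cV[R]_q) :=
  [/\ open W, smooth_on W u &
      forall s tau, W (s, tau) -> U (jet (slice u tau) s)].

(* bracket of vector fields, given by their coefficient vectors *)
Definition bracket (v w : M -> M) : M -> M :=
  fun z => 'D_(v z) w z - 'D_(w z) v z.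

Context {G : groupType} {r : nat}.
Context (X : lieGroup R G r) (act : G -> M -> M) (D : set M).

Record smooth_action : Prop := SmoothAction {
  act_open : open D ;
  act_stable : forall g z, D z -> D (act g z) ;
  act_one : forall z, D z -> act 1%g z = z ;
  act_mul : forall g h z, D z -> act (g * h)%g z = act g (act h z) ;
  act_smooth : forall i,
    smooth_on [set xz : 'rV[R]_r * M | (coord X i @` dom X i) xz.1 /\ D xz.2]
              (fun xz => act (param X i xz.1) xz.2)
}.

(* The action comes from an action (s, u) |-> (s, u~) on the order 0
   coordinates, and its other components are obtained by the chain rule: the
   jets of a curve are sent to the jets of the transformed curve. *)
Record prolonged : Prop := Prolonged {
  s_invariant : forall g z, D z -> (act g z).1 = z.1 ;
  act_point : forall g z z', D z -> D z' ->
    z.1 = z'.1 -> order0 z = order0 z' ->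
    order0 (act g z) = order0 (act g z') ;
  act_prolonged : forall g A u, curve_in D A u -> forall s, A s ->
    act g (jet u s) = jet (fun t => order0 (act g (jet u t))) s
}.

Definition orbit (z : M) : set M := [set act g z | g in [set: G]].

(* v_j, in the coordinates of the chart i0, which must contain the identity;
   the identity need not have coordinates 0 *)
Definition infinitesimal (i0 : nat) (j : 'I_r) (z : M) : M :=
  'D_(delta_mx ord0 j) (fun a => act (param X i0 a) z) (coord X i0 1%g).

Section Frame.
Context (i0 : nat).
Notation v := (infinitesimal i0).

Definition XG : set (M -> M) :=
  [set w | exists c : 'rV[R]_r,
     forall z, D z -> w z = \sum_j c ord0 j *: v j z].

(* coordinates in the basis v_1, ..., v_r, for fields of XG *)
Definition XG_coord (w : M -> M) : 'rV[R]_r :=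
  xget 0 [set c : 'rV[R]_r |
     forall z, D z -> w z = \sum_j c ord0 j *: v j z].

Definition XG_trace (T : (M -> M) -> (M -> M)) : R :=
  \sum_j XG_coord (T (v j)) ord0 j.

Definition killing (w1 w2 : M -> M) : R :=
  XG_trace (bracket w1 \o bracket w2).

Definition killing_mx : 'M[R]_r := \matrix_(i, j) killing (v i) (v j).

Definition lie_algebra_XG : Prop :=
  forall w1 w2, XG w1 -> XG w2 -> XG (bracket w1 w2).

Definition semisimple_XG : Prop := lie_algebra_XG /\ killing_mx \in unitmx.

(* Tg^-1 w(g . z), Tg^-1 being the tangent map of z |-> g^-1 . z *)
Definition Ad (g : G) (w : M -> M) : M -> M :=
  fun z => 'D_(w (act g z)) (act g^-1%g) (act g z).

Definition is_Ad_matrix (g : G) (A : 'M[R]_r) : Prop :=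
  forall i z, D z -> Ad g (v i) z = \sum_j A i j *: v j z.

(* K is near each of its points a regular level set of a map to R^r, so
   dim K = dim M - r and T_k K = ker dF_k; the last clause says
   T_k K + T_k O(k) = T_k M. *)
Definition transversal_surface (U K : set M) : Prop :=
  forall k, K k -> exists (O : set M) (F : M -> 'rV[R]_r),
    [/\ [/\ open O, O k & O `<=` U], smooth_on O F,
        forall z, O z -> (K z <-> F z = 0),
        forall y, exists w, 'D_w F k = y &
        forall w, exists c : 'I_r -> R, 'D_(w - \sum_j c j *: v j k) F k = 0].

(* The dimension of an orbit is the rank of v_1, ..., v_r along it; since this
   rank is constant the orbits foliate U. *)
Record free_regular (U K : set M) : Prop := FreeRegular {
  dom_open : open U ;
  dom_sub : U `<=` D ;
  act_free : forall g z, U z -> act g z = z -> g = 1%g ;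
  orbit_dim : forall z (c : 'I_r -> R), U z ->
    \sum_j c j *: v j z = 0 -> forall j, c j = 0 ;
  section_sub : K `<=` U ;
  section_transversal : transversal_surface U K ;
  section_meets : forall z, U z -> exists! k, orbit z k /\ K k ;
  section_element : forall z k, U z -> orbit z k -> K k ->
    exists! g, act g z = k
}.

Definition smooth_to_group (U : set M) (rho : M -> G) : Prop :=
  forall z, U z -> exists i (O : set M),
    [/\ open O, O z, forall x, O x -> dom X i (rho x) &
        smooth_on O (fun x => coord X i (rho x))].

Record right_moving_frame (U K : set M) (rho : M -> G) : Prop :=
  RightMovingFrame {
    frame_regular : free_regular U K ;
    frame_section : forall z, U z -> K (act (rho z) z) ;
    frame_smooth : smooth_to_group U rho
  }.

Section Invariants.
Context (U : set M) (rho : M -> G).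

Definition invariantise (z : M) : M := act (rho z) z.

Definition differential_invariant (T : Type) (F : M -> T) : Prop :=
  forall g z, U z -> U (act g z) -> F (act g z) = F z.

(* I(u^alpha_{tau J})(s, tau), for all alpha, J: the tau-derivative of the
   transformed jet for fixed g, then evaluated at g = rho(z). *)
Definition I_tauJ (u : R * R -> 'cV[R]_q) (s tau : R) : 'M[R]_(q, n.+1) :=
  let g := rho (jet (slice u tau) s) in
  (derive1 (fun t => act g (jet (slice u t) s)) tau).2.

Definition I_tau (u : R * R -> 'cV[R]_q) (a : 'I_q) (s tau : R) : R :=
  I_tauJ u s tau a ord0.

Definition Omega (a : 'I_q) (z : M) : 'M[R]_(r, n.+1) :=
  \matrix_(j, k) (v j z).2 a k.

Definition upsilon (C : 'I_q -> M -> 'cV[R]_n.+1) (z : M) : 'cV[R]_r :=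
  \sum_a Omega a (invariantise z) *m C a z.

(* kappa^j = I(u^alpha_k) where (alpha, k) = gen j *)
Context {p : nat} (gen : 'I_p -> 'I_q * 'I_n.+1).

Definition kappa (j : 'I_p) (z : M) : R :=
  (invariantise z).2 (gen j).1 (gen j).2.

(* the matrix of the D_s^k kappa^j, k <= m, along the curve u *)
Definition kappa_jet (m : nat) (u : R -> 'cV[R]_q) (s : R) : 'M[R]_(p, m.+1) :=
  \matrix_(j, k) derive1n k (fun t => kappa j (jet u t)) s.

Definition generating : Prop :=
  forall F : M -> R, smooth_on U F -> differential_invariant F ->
  exists m (Phi : R -> 'M[R]_(p, m.+1) -> R),
  forall A u, curve_in U A u -> forall s, A s ->
    F (jet u s) = Phi s (kappa_jet m u s).

(* L and the coefficients of
   H_{j,alpha} = \sum_(i < d) h j alpha i (kappa, kappa_s, ...) D_s^i *)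
Context {m d : nat} (L : 'M[R]_(p, m.+1) -> R).
Context (h : 'I_p -> 'I_q -> 'I_d -> 'M[R]_(p, m.+1) -> R).

Definition smooth_coefficients (V : set 'M[R]_(p, m.+1)) : Prop :=
  [/\ open V,
      forall A u, curve_in U A u -> forall s, A s -> V (kappa_jet m u s),
      smooth_on V L & forall j a i, smooth_on V (h j a i)].

Definition D_tau_kappa (u : R * R -> 'cV[R]_q) (j : 'I_p) (s tau : R) : R :=
  derive1 (fun t => kappa j (jet (slice u t) s)) tau.

Definition syzygies : Prop :=
  forall W u, variation_in U W u -> forall s tau, W (s, tau) -> forall j,
  D_tau_kappa u j s tau =
  \sum_a \sum_(i < d) h j a i (kappa_jet m (slice u tau) s) *
                      derive1n i (fun x => I_tau u a x tau) s.

Definition dL (j : 'I_p) (k : 'I_m.+1) (u : R -> 'cV[R]_q) (s : R) : R :=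
  'D_(delta_mx j k) L (kappa_jet m u s).

(* Euler operator of L with respect to kappa^j *)
Definition E_kappa (j : 'I_p) (u : R -> 'cV[R]_q) (s : R) : R :=
  \sum_(k < m.+1) (-1) ^+ k * derive1n k (dL j k u) s.

Definition H_E (j : 'I_p) (a : 'I_q) (i : 'I_d) (u : R -> 'cV[R]_q) (s : R) : R :=
  h j a i (kappa_jet m u s) * E_kappa j u s.

(* E^alpha(L) = \sum_j H_{j,alpha}^* (E_kappa j) *)
Definition euler_lagrange (a : 'I_q) (u : R -> 'cV[R]_q) (s : R) : R :=
  \sum_j \sum_(i < d) (-1) ^+ i * derive1n i (H_E j a i u) s.

Definition solution (A : set R) (u : R -> 'cV[R]_q) : Prop :=
  [/\ is_interval A, curve_in U A u &
      forall a s, A s -> euler_lagrange a u s = 0].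

Definition first_integral (T : Type) (F : M -> T) : Prop :=
  forall A u, solution A u -> exists k, forall s, A s -> F (jet u s) = k.

(* f D^k g = (-1)^k (D^k f) g + D (ibp k f g) *)
Definition ibp (k : nat) (f g : R -> R) (s : R) : R :=
  \sum_(l < k) (-1) ^+ l * derive1n l f s * derive1n (k.-1 - l) g s.

(* P: the boundary terms of the integration by parts of
   \sum_(j, k) dL j k * D_s^k D_tau kappa^j, then, after substitution of the
   syzygies, of \sum_(j, alpha) E_kappa j * H_{j,alpha} I^alpha_tau. *)
Definition P_boundary (u : R * R -> 'cV[R]_q) (s tau : R) : R :=
  \sum_j \sum_(k < m.+1)
     ibp k (dL j k (slice u tau)) (fun x => D_tau_kappa u j x tau) s +
  \sum_j \sum_a \sum_(i < d)
     ibp i (H_E j a i (slice u tau)) (fun x => I_tau u a x tau) s.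

(* C a is the column of the C^a_J.  Since the I^a_{tau J} are independent, the
   last clause determines C. *)
Definition boundary_coefficients (C : 'I_q -> M -> 'cV[R]_n.+1) : Prop :=
  [/\ forall a, smooth_on U (C a),
      forall a, differential_invariant (C a) &
      forall W u, variation_in U W u -> forall s tau, W (s, tau) ->
        P_boundary u s tau =
        \sum_a \sum_k I_tauJ u s tau a k * C a (jet (slice u tau) s) k ord0].

End Invariants.
End Frame.
End Setting.

(* Main.v *)
Require Import Defs.
From HB Require Import structures.
From mathcomp Require Import all_boot all_order all_algebra.
From mathcomp Require Import all_classical all_reals all_analysis.
From mathcomp Require Import ring lra.
Import Order.TTheory GRing.Theory Num.Theory.
Import numFieldNormedType.Exports.
Local Open Scope ring_scope.
Local Open Scope classical_set_scope.
Set Implicit Arguments.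
Unset Strict Implicit.
Unset Printing Implicit Defensive.

(** A curve [g(tau)] in [G] leaving the identity with velocity [v_j] moves a solution
    [u] through the variation [u(s, tau)] whose jets are [g(tau) . jet u s].  The invariants [kappa] do not
    change along it, so the syzygies and the integration by parts leave, at [tau = 0],
    [D_s P = - sum_alpha E^alpha(L) I^alpha_tau = 0], and [P] is constant.  The
    [I^alpha_{tau J}] of this variation are the components of [T rho (v_j)], that
    is of [Ad_{rho^-1}(v_j)] at the point [I(z)], which turns [P] into the [j]-th
    entry of [Ad(rho)^-1 upsilon(I)].  Finally [Ad_g] preserves brackets, because
    second derivatives commute, so its matrix is an isometry of the Killing form:
    [A B A^T = B]. *)

(** * Continuous linear maps and coordinates *)

(** Smoothness is stated through iterated derivatives along fixed directions, whereas the chain rule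
    produces directions that move with the point. Coordinates on the target of the inner map reduce
    the second kind to the first; this is the role of [has_coords]. The curve in [G] is a coordinate
    line of the chart [i0], since only its velocity at [tau = 0] matters. It stays in the chart, and
    keeps the moved jet in [U], only for [tau] in an open set that depends on [s]; the variation
    therefore lives on an open set around the line [tau = 0]. Identities between fields of the
    algebra become matrix identities by evaluation at one jet of [U], where [v_1, ..., v_r] are
    independent. The constants of Noether's theorem form a column [A^-1 upsilon(I)] with
    [A = Ad(rho)], while [A B A^T = B] is about rows of coefficients of fields. Inverting it gives
    [A^-T B^-1 A^-1 = B^-1], the identity that columns need: this is why [B^-1] occurs in the
    quadratic form and where semisimplicity enters. *)

Section ContinuousLinear.
Context {R : realType}.
Implicit Types V W Z : normedModType R.

(** An unbundled predicate, so that lambda terms such as [fun A => A i j] can be used without first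
    being given a structure of linear map. *)
Definition clin {V W} (l : V -> W) : Prop := linear l /\ continuous l.

Lemma clin_diff {V W} (l : V -> W) x : clin l -> is_diff x l l.
Proof.
move=> [ll cl].
pose lM := GRing.isLinear.Build _ _ _ _ _ ll.
pose lL : {linear V -> W} := HB.pack l lM.
have -> : l = lL by [].
apply: DiffDef; first exact: linear_differentiable.
exact: diff_lin.
Qed.

Lemma clin_differentiable {V W} (l : V -> W) x : clin l -> differentiable l x.
Proof. by move=> /(clin_diff x) []. Qed.

Lemma clinD {V W} (l : V -> W) x y : clin l -> l (x + y) = l x + l y.
Proof. by move=> [ll _]; have := ll 1 x y; rewrite !scale1r. Qed.

Lemma clin0 {V W} (l : V -> W) : clin l -> l 0 = 0.
Proof.
by move=> cl; have := clinD 0 0 cl; rewrite addr0 => /(canLR (addrK _)); rewrite subrr.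
Qed.

Lemma clinZ {V W} (l : V -> W) a x : clin l -> l (a *: x) = a *: l x.
Proof.
by move=> cl; have [ll _] := cl; rewrite -[a *: x]addr0 ll (clin0 cl) addr0.
Qed.

Lemma clin_sum {V W} (l : V -> W) (I : Type) (s : seq I) P (F : I -> V) : clin l ->
  l (\sum_(i <- s | P i) F i) = \sum_(i <- s | P i) l (F i).
Proof.
by move=> cl; apply: (big_morph l (fun x y => clinD x y cl) (clin0 cl)).
Qed.

Lemma clin_derive {V W} (l : V -> W) x v : clin l -> 'D_v l x = l v.
Proof.
move=> /(clin_diff x) [dl e]; rewrite deriveE //.
exact: (congr1 (fun f => f v) e).
Qed.

Lemma clin_comp {V W Z} (l : V -> W) (l' : W -> Z) :
  clin l -> clin l' -> clin (l' \o l).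
Proof.
move=> cl cl'; split.
  by move=> a x y /=; rewrite (clinD _ _ cl) (clinZ _ _ cl) (clinD _ _ cl') (clinZ _ _ cl').
by move=> x; apply: continuous_comp; [exact: cl.2 | exact: cl'.2].
Qed.

Lemma clin_entry m n (i : 'I_m) (j : 'I_n) : clin (fun A : 'M[R]_(m, n) => A i j).
Proof.
by split; [move=> a A B; rewrite !mxE | exact: coord_continuous].
Qed.

Lemma clin_fst {V W} : clin (@fst V W).
Proof. by split => // x; apply: cvg_fst. Qed.

Lemma clin_snd {V W} : clin (@snd V W).
Proof. by split => // x; apply: cvg_snd. Qed.

Lemma clin_inl {V W} : clin (fun x : V => (x, 0 : W)).
Proof.
split; first by move=> a x y; apply/pair_equal_spec; split=> //=; rewrite scaler0 addr0.
by move=> x; apply: (@cvg_pair _ _ _ _ (nbhs x) (nbhs (0 : W))) => //; exact: cvg_cst.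
Qed.

Lemma clin_inr {V W} : clin (fun y : W => (0 : V, y)).
Proof.
split; first by move=> a x y; apply/pair_equal_spec; split=> //=; rewrite scaler0 addr0.
by move=> x; apply: (@cvg_pair _ _ _ _ (nbhs (0 : V)) (nbhs x)) => //; exact: cvg_cst.
Qed.

Lemma clin_scalel {W} (w : W) : clin (fun a : R => a *: w).
Proof.
split; last exact: scalel_continuous.
by move=> a x y; rewrite scalerDl scalerA.
Qed.

Lemma clin_id {V} : clin (@id V).
Proof. by split => // x; exact: cvg_id. Qed.

(** Finite dimension, in a form that passes to products. The coordinate forms are continuous, so
    that composing a smooth map with them keeps it smooth. *)
Definition has_coords V : Prop :=
  exists N (e : 'I_N -> V) (l : 'I_N -> V -> R),
    (forall i, clin (l i)) /\ (forall x, x = \sum_i l i x *: e i).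

Lemma has_coords_fin V (I : finType) (e : I -> V) (l : I -> V -> R) :
  (forall i, clin (l i)) -> (forall x, x = \sum_i l i x *: e i) -> has_coords V.
Proof.
move=> cl el; exists #|I|, (fun i => e (enum_val i)), (fun i => l (enum_val i)).
by split=> // x; rewrite {1}(el x) (big_enum_val (fun i => l i x *: e i)).
Qed.

Lemma has_coords_real : has_coords R.
Proof.
apply: (@has_coords_fin R unit (fun=> 1 : R) (fun _ x => x)) => [_|x].
  exact: clin_id.
by rewrite big_const card_unit /= addr0; exact/esym/mulr1.
Qed.

Lemma has_coords_mx m n : has_coords 'M[R]_(m, n).
Proof.
apply: (@has_coords_fin _ ('I_m * 'I_n)%type (fun ij => delta_mx ij.1 ij.2)
  (fun ij A => A ij.1 ij.2)) => [ij|A]; first exact: clin_entry.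
by rewrite {1}(matrix_sum_delta A) pair_bigA.
Qed.

Lemma has_coords_prod V W : has_coords V -> has_coords W -> has_coords (V * W)%type.
Proof.
move=> [n [e [l [cl el]]]] [n' [e' [l' [cl' el']]]].
apply: (@has_coords_fin _ ('I_n + 'I_n')%type
  (fun i => match i with inl i => (e i, 0) | inr i => (0, e' i) end)
  (fun i x => match i with inl i => l i x.1 | inr i => l' i x.2 end)) => [[] i|[x y]].
- exact: (clin_comp clin_fst (cl i)).
- exact: (clin_comp clin_snd (cl' i)).
rewrite big_sumType /=.
have -> : \sum_i l i x *: (e i, 0 : W) = (x, 0).
  rewrite {2}(el x) (clin_sum _ _ _ (@clin_inl V W)).
  by apply: eq_bigr => i _; rewrite (clinZ _ _ (@clin_inl V W)).
have -> : \sum_i l' i y *: (0 : V, e' i) = (0, y).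
  rewrite {2}(el' y) (clin_sum _ _ _ (@clin_inr V W)).
  by apply: eq_bigr => i _; rewrite (clinZ _ _ (@clin_inr V W)).
by congr pair; rewrite /= ?addr0 ?add0r.
Qed.

End ContinuousLinear.

(** * Calculus of smooth maps *)

Section SmoothCalculus.
Context {R : realType}.
Implicit Types V W Z : normedModType R.

(** The first-order expansion of [f] at [x] is also one of [g], since only the germ enters;
    [diff_unique] then identifies the two differentials. *)
Lemma near_eq_differentiable V W (f g : V -> W) x :
  {near x, f =1 g} -> differentiable f x -> differentiable g x.
Proof.
move=> fg df.
have [cdf dfE] := (diff_locallyP x f).1 df.
have gE : g \o shift x = cst (g x) + 'd f x +o_ 0 id.
  apply/eqaddoP => e e0.
  have := (eqaddoP _ _ _ _).1 dfE e e0.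
  apply: filter_app.
  have : \forall y \near 0, f (y + x) = g (y + x).
    have : \forall y \near x, f y = g y := fg.
    by rewrite (near_shift 0) /= subr0.
  apply: filter_app; near=> y => fgy.
  rewrite /= !fctE /= fgy.
  by rewrite -(nbhs_singleton fg).
have dgE : 'd g x = 'd f x :> (V -> W) by apply: diff_unique.
by apply/diff_locallyP; rewrite dgE.
Unshelve. all: by end_near. Qed.

Lemma open_eq_near V W (A : set V) (f g : V -> W) x :
  open A -> A x -> (forall y, A y -> f y = g y) -> {near x, f =1 g}.
Proof.
move=> oA Ax fg.
by have := open_nbhs_nbhs (conj oA Ax); rewrite /prop_near1; apply: filter_app;
  near do apply: fg.
Unshelve. all: by end_near. Qed.

Lemma eq_open_derive V W (A : set V) (f g : V -> W) x v :
  open A -> A x -> (forall y, A y -> f y = g y) -> 'D_v f x = 'D_v g x.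
Proof. by move=> oA Ax fg; apply/near_eq_derive/open_eq_near/fg. Qed.

(** The calculus rules below rest on this: a derivative is computed by a formula valid only on [A],
    and smoothness is carried over from the formula. *)
Lemma eq_differentiable_upto k V W (A : set V) (f g : V -> W) :
  open A -> (forall y, A y -> f y = g y) ->
  differentiable_upto k A f -> differentiable_upto k A g.
Proof.
move=> oA; elim: k f g => [//|k IH] f g fg [df ddf]; split.
  by move=> x Ax; apply: near_eq_differentiable (df x Ax); exact: open_eq_near fg.
move=> v; apply: IH (ddf v) => y Ay; exact: eq_open_derive fg.
Qed.

Lemma eq_smooth_on V W (A : set V) (f g : V -> W) :
  open A -> (forall y, A y -> f y = g y) -> smooth_on A f -> smooth_on A g.
Proof. by move=> oA fg sf k; apply: eq_differentiable_upto fg (sf k). Qed.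

Lemma sub_differentiable_upto k V W (A B : set V) (f : V -> W) :
  B `<=` A -> differentiable_upto k A f -> differentiable_upto k B f.
Proof.
move=> BA; elim: k f => [//|k IH] f [df ddf].
by split=> [x Bx|v]; [apply: df; exact: BA|apply: IH; exact: ddf].
Qed.

Lemma sub_smooth_on V W (A B : set V) (f : V -> W) :
  B `<=` A -> smooth_on A f -> smooth_on B f.
Proof. by move=> BA sf k; apply: sub_differentiable_upto (sf k). Qed.

(** Serves for the moving frame, whose smoothness is expressed in charts of [G] that change from
    point to point. *)
Lemma local_smooth_on V W (A : set V) (f : V -> W) :
  (forall x, A x -> exists B : set V, [/\ open B, B x & smooth_on B f]) ->
  smooth_on A f.
Proof.
move=> loc k.
have {}loc : forall x, A x -> exists B : set V, B x /\ differentiable_upto k B f.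
  by move=> x /loc [B [_ Ox sO]]; exists B; split.
elim: k f loc => [//|k IH] f loc; split=> [x /loc[B [Ox [dO _]]]|v]; first exact: dO.
by apply: IH => x /loc[B [Ox [_ dO]]]; exists B; split=> //; exact: dO.
Qed.

Lemma smooth_on_derive V W (A : set V) (f : V -> W) v :
  smooth_on A f -> smooth_on A ('D_v f).
Proof. by move=> sf k; have [_] := sf k.+1; apply. Qed.

Lemma smooth_on_differentiable V W (A : set V) (f : V -> W) x :
  smooth_on A f -> A x -> differentiable f x.
Proof. by move=> sf; have [df _] := sf 1%N; exact: df. Qed.

Lemma differentiable_upto_le k V W (A : set V) (f : V -> W) :
  differentiable_upto k.+1 A f -> differentiable_upto k A f.
Proof.
elim: k f => [//|k IH] f [df ddf]; split=> // v; apply: IH; exact: ddf.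
Qed.

Lemma smooth_on_cst V W (A : set V) (w : W) : smooth_on A (fun _ => w).
Proof.
move=> k; elim: k w => [//|k IH] w; split=> [x _|v]; first exact: differentiable_cst.
have -> : 'D_v (fun _ : V => w) = fun=> 0 by apply/funext => x; exact: derive_cst.
exact: IH.
Qed.

Lemma smooth_on_clin V W (A : set V) (l : V -> W) : clin l -> smooth_on A l.
Proof.
move=> cl [//|k]; split=> [x _|v]; first exact: clin_differentiable.
have -> : 'D_v l = fun=> l v by apply/funext => x; exact: clin_derive.
exact: smooth_on_cst.
Qed.

Lemma derive_comp V W Z (f : V -> W) (g : W -> Z) x v :
  differentiable f x -> differentiable g (f x) ->
  'D_v (g \o f) x = 'D_('D_v f x) g (f x).
Proof.
move=> df dg; rewrite !deriveE //; last exact: differentiable_comp.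
by rewrite diff_comp.
Qed.

Lemma derive_clin_comp V W Z (f : V -> W) (l : W -> Z) x v :
  clin l -> differentiable f x -> 'D_v (fun y => l (f y)) x = l ('D_v f x).
Proof.
move=> cl df; rewrite (derive_comp v df (clin_differentiable _ cl)).
exact: clin_derive.
Qed.

Lemma differentiable_clin_comp V W Z (f : V -> W) (l : W -> Z) x :
  clin l -> differentiable f x -> differentiable (fun y => l (f y)) x.
Proof.
by move=> cl df; apply: (differentiable_comp df); exact: clin_differentiable.
Qed.

Lemma differentiable_upto_clin_comp k V W Z (A : set V) (f : V -> W) (l : W -> Z) :
  open A -> clin l -> differentiable_upto k A f ->
  differentiable_upto k A (fun y => l (f y)).
Proof.
move=> oA cl; elim: k f => [//|k IH] f [df ddf]; split.
  by move=> x Ax; apply: differentiable_clin_comp => //; exact: df.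
move=> v; apply: eq_differentiable_upto (IH _ (ddf v)) => // y Ay.
by rewrite (derive_clin_comp _ cl) //; exact: df.
Qed.

Lemma smooth_on_clin_comp V W Z (A : set V) (f : V -> W) (l : W -> Z) :
  open A -> clin l -> smooth_on A f -> smooth_on A (fun y => l (f y)).
Proof. by move=> oA cl sf k; exact: differentiable_upto_clin_comp. Qed.

Lemma differentiable_uptoD k V W (A : set V) (f g : V -> W) :
  open A -> differentiable_upto k A f -> differentiable_upto k A g ->
  differentiable_upto k A (fun y => f y + g y).
Proof.
move=> oA; elim: k f g => [//|k IH] f g [df ddf] [dg ddg]; split.
  by move=> x Ax; apply: differentiableD; [exact: df|exact: dg].
move=> v; apply: eq_differentiable_upto (IH _ _ (ddf v) (ddg v)) => // y Ay.
by rewrite [RHS](@deriveD _ _ _ f g) //; apply: diff_derivable; [exact: df|exact: dg].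
Qed.

Lemma smooth_onD V W (A : set V) (f g : V -> W) :
  open A -> smooth_on A f -> smooth_on A g -> smooth_on A (fun y => f y + g y).
Proof. by move=> oA sf sg k; exact: differentiable_uptoD. Qed.

Lemma differentiable_upto_sum k V W (A : set V) (I : Type) (s : seq I) (f : I -> V -> W) :
  open A -> (forall i, differentiable_upto k A (f i)) ->
  differentiable_upto k A (fun y => \sum_(i <- s) f i y).
Proof.
move=> oA sf; elim: s => [|i s IH].
  apply: eq_differentiable_upto (smooth_on_cst A 0 k) => // y _; by rewrite big_nil.
apply: eq_differentiable_upto (differentiable_uptoD oA (sf i) IH) => // y _.
by rewrite big_cons.
Qed.

Lemma smooth_on_sum V W (A : set V) (I : Type) (s : seq I) (f : I -> V -> W) :
  open A -> (forall i, smooth_on A (f i)) ->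
  smooth_on A (fun y => \sum_(i <- s) f i y).
Proof. by move=> oA sf k; apply: differentiable_upto_sum => // i; exact: sf. Qed.

(** Scaling is declared bilinear so that the product rule follows from the differential of a
    continuous bilinear map, composed with the pair [(a, f)]. *)
Lemma scale_is_bilinear W :
  bilinear_for
    (GRing.Scale.Law.clone _ _ *:%R _) (GRing.Scale.Law.clone _ _ *:%R _)
    (@GRing.scale R W).
Proof.
split=> [u'|u] a x y /=; first by rewrite scalerDl scalerA.
by rewrite scalerDr !scalerA mulrC.
Qed.

HB.instance Definition _ W :=
  bilinear_isBilinear.Build R R W W _ _ (@GRing.scale R W) (scale_is_bilinear W).

Lemma is_diff_scale V W (a : V -> R) (f : V -> W) x :
  differentiable a x -> differentiable f x ->
  is_diff x (fun y => a y *: f y) (fun v => a x *: 'd f x v + 'd a x v *: f x).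
Proof.
move=> da df.
have ds : is_diff (a x, f x) (fun p : R * W => p.1 *: p.2)
    (fun q => a x *: q.2 + q.1 *: f x).
  have cs : continuous (fun p : R * W => p.1 *: p.2) by exact: scale_continuous.
  apply: DiffDef; first exact: (differentiable_bilin _ cs).
  exact: (@diff_bilin _ _ _ _ (@GRing.scale R W) _ cs).
have dp := is_diff_pair (differentiableP da) (differentiableP df).
exact: (is_diff_comp dp ds).
Qed.

Lemma differentiable_scale V W (a : V -> R) (f : V -> W) x :
  differentiable a x -> differentiable f x -> differentiable (fun y => a y *: f y) x.
Proof. by move=> da df; have [] := is_diff_scale da df. Qed.

Lemma derive_scale V W (a : V -> R) (f : V -> W) x v :
  differentiable a x -> differentiable f x ->
  'D_v (fun y => a y *: f y) x = 'D_v a x *: f x + a x *: 'D_v f x.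
Proof.
move=> da df; have [dd ddE] := is_diff_scale da df.
rewrite deriveE // (deriveE _ da) (deriveE _ df) addrC.
exact: (congr1 (fun g => g v) ddE).
Qed.

Lemma differentiable_uptoZ k V W (A : set V) (a : V -> R) (f : V -> W) :
  open A -> differentiable_upto k A a -> differentiable_upto k A f ->
  differentiable_upto k A (fun y => a y *: f y).
Proof.
move=> oA; elim: k a f => [//|k IH] a f saf sf; split.
  by move=> x Ax; apply: differentiable_scale; [exact: saf.1|exact: sf.1].
move=> v; have [[da dda] [df ddf]] := (saf, sf).
apply: eq_differentiable_upto (differentiable_uptoD oA
  (IH _ _ (dda v) (differentiable_upto_le sf))
  (IH _ _ (differentiable_upto_le saf) (ddf v))) => // y Ay.
by rewrite derive_scale //; [exact: da|exact: df].
Qed.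

Lemma smooth_onZ V W (A : set V) (a : V -> R) (f : V -> W) :
  open A -> smooth_on A a -> smooth_on A f -> smooth_on A (fun y => a y *: f y).
Proof. by move=> oA sa sf k; exact: differentiable_uptoZ. Qed.

Lemma derive_coords V W (f : V -> W) x N (e : 'I_N -> V) (l : 'I_N -> V -> R) v :
  v = \sum_i l i v *: e i -> differentiable f x ->
  'D_v f x = \sum_i l i v *: 'D_(e i) f x.
Proof.
move=> ve df; rewrite deriveE // {1}ve linear_sum; apply: eq_bigr => i _.
by rewrite linearZ deriveE.
Qed.

(** With [f] smooth to all orders, the induction can run on the order of [g] alone. *)
Lemma differentiable_upto_comp k V W Z (A : set V) (B : set W)
    (f : V -> W) (g : W -> Z) :
  has_coords W -> open A -> open B -> (forall x, A x -> B (f x)) ->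
  smooth_on A f -> differentiable_upto k B g ->
  differentiable_upto k A (fun x => g (f x)).
Proof.
move=> [N [e [l [cl el]]]] oA oB AB sf.
have df x : A x -> differentiable f x := smooth_on_differentiable sf.
elim: k g => [//|k IH] g [dg ddg]; split.
  move=> x Ax; apply: (@differentiable_comp _ _ _ _ f g); first exact: df.
  by apply: dg; exact: AB.
move=> v.
(* The direction ['D_v f y] moves with [y]. Expanded along the fixed vectors [e i], the derivative
   involves only the maps ['D_(e i) g], to which the induction hypothesis applies. *)
suff : differentiable_upto k A
    (fun y => \sum_i l i ('D_v f y) *: 'D_(e i) g (f y)).
  apply: eq_differentiable_upto => // y Ay.
  rewrite [RHS](@derive_comp _ _ _ f g y v); [|exact: df|by apply: dg; exact: AB].
  by rewrite [RHS](derive_coords (el _)) //; apply: dg; exact: AB.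
apply: differentiable_upto_sum => // i.
apply: differentiable_uptoZ => //; last exact: (IH _ (ddg (e i))).
by apply: differentiable_upto_clin_comp => //; exact: smooth_on_derive.
Qed.

Lemma smooth_on_comp V W Z (A : set V) (B : set W) (f : V -> W) (g : W -> Z) :
  has_coords W -> open A -> open B -> (forall x, A x -> B (f x)) ->
  smooth_on A f -> smooth_on B g -> smooth_on A (fun x => g (f x)).
Proof.
by move=> hW oA oB AB sf sg k; apply: (differentiable_upto_comp hW oA oB AB sf (sg k)).
Qed.

Lemma smooth_on_pair V W Z (A : set V) (f : V -> W) (g : V -> Z) :
  open A -> smooth_on A f -> smooth_on A g -> smooth_on A (fun x => (f x, g x)).
Proof.
move=> oA sf sg.
have := smooth_onD oA (smooth_on_clin_comp oA (@clin_inl R W Z) sf)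
   (smooth_on_clin_comp oA (@clin_inr R W Z) sg).
apply: eq_smooth_on => // y _; apply/pair_equal_spec; split=> /=.
  exact: addr0.
exact: add0r.
Qed.

Lemma smooth_on_mx V (A : set V) m n (f : V -> 'M[R]_(m, n)) :
  open A -> (forall i j, smooth_on A (fun x => f x i j)) -> smooth_on A f.
Proof.
move=> oA sf.
have : smooth_on A (fun x => \sum_i \sum_j f x i j *: (delta_mx i j : 'M[R]_(m, n))).
  apply: smooth_on_sum => // i; apply: smooth_on_sum => // j.
  apply: smooth_onZ => //; exact: smooth_on_cst.
by apply: eq_smooth_on => // y _; rewrite -matrix_sum_delta.
Qed.

Lemma smooth_on_entry V (A : set V) m n (f : V -> 'M[R]_(m, n)) i j :
  open A -> smooth_on A f -> smooth_on A (fun x => f x i j).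
Proof. by move=> oA sf; exact: (smooth_on_clin_comp oA (clin_entry i j) sf). Qed.

Lemma smooth_onM V (A : set V) (f g : V -> R) :
  open A -> smooth_on A f -> smooth_on A g -> smooth_on A (fun y => f y * g y).
Proof. exact: (@smooth_onZ V R). Qed.

Lemma smooth_on_continuous V W (A : set V) (f : V -> W) x :
  smooth_on A f -> A x -> {for x, continuous f}.
Proof. by move=> sf Ax; apply/differentiable_continuous/(smooth_on_differentiable sf). Qed.

Lemma open_preimage V W (A : set V) (B : set W) (f : V -> W) :
  open A -> open B -> smooth_on A f -> open [set x | A x /\ B (f x)].
Proof.
move=> oA oB sf; rewrite openE => x [Ax Bfx].
have nB : nbhs (f x) B by exact: open_nbhs_nbhs.
have nA : nbhs x A by exact: open_nbhs_nbhs.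
have := smooth_on_continuous sf Ax nB.
by rewrite /interior nbhs_simpl => nfB; apply: filterI nA nfB.
Qed.

(** The difference quotients on the two sides are the same function of [h]. *)
Lemma derive_slicel V W Z (f : V * W -> Z) a b u :
  'D_u (fun x => f (x, b)) a = 'D_(u, 0) f (a, b).
Proof.
have e : (fun h : R => h^-1 *: ((f \o shift (a, b)) (h *: (u, 0 : W)) - f (a, b))) =
    (fun h : R => h^-1 *: (((fun x => f (x, b)) \o shift a) (h *: u) - f (a, b))).
  apply/funext => h /=; congr (_ *: (f _ - _)); apply/pair_equal_spec.
  by rewrite /= scaler0 add0r.
by rewrite /derive e.
Qed.

Lemma derive_slicer V W Z (f : V * W -> Z) a b u :
  'D_u (fun y => f (a, y)) b = 'D_(0, u) f (a, b).
Proof.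
have e : (fun h : R => h^-1 *: ((f \o shift (a, b)) (h *: (0 : V, u)) - f (a, b))) =
    (fun h : R => h^-1 *: (((fun y => f (a, y)) \o shift b) (h *: u) - f (a, b))).
  apply/funext => h /=; congr (_ *: (f _ - _)); apply/pair_equal_spec.
  by rewrite /= scaler0 add0r.
by rewrite /derive e.
Qed.

(** Meant for [I_tau] along the group variation, a derivative whose base point and direction both
    move with [s]. *)
Lemma smooth_on_dir_derive V W Z (A : set V) (B : set W) (f w : V -> W) (g : W -> Z) :
  has_coords W -> open A -> open B -> (forall x, A x -> B (f x)) ->
  smooth_on A f -> smooth_on A w -> smooth_on B g ->
  smooth_on A (fun x => 'D_(w x) g (f x)).
Proof.
move=> hW oA oB AB sf sw sg; have [N [e [l [cl el]]]] := hW.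
have : smooth_on A (fun x => \sum_i l i (w x) *: 'D_(e i) g (f x)).
  apply: smooth_on_sum => // i; apply: smooth_onZ => //.
    exact: smooth_on_clin_comp.
  exact: (smooth_on_comp hW oA oB AB sf (smooth_on_derive (e i) sg)).
apply: eq_smooth_on => // x Ax.
by rewrite [RHS](derive_coords (el _)) //; apply: smooth_on_differentiable sg (AB x Ax).
Qed.

End SmoothCalculus.

(** * Symmetry of second derivatives and brackets *)

Section Schwarz.
Context {R : realType}.
Implicit Types V W : normedModType R.

Lemma is_derive_along V W (f : V -> W) c v (t : R) :
  differentiable f (c + t *: v) ->
  is_derive t 1 (fun a => f (c + a *: v)) ('D_v f (c + t *: v)).
Proof.
move=> df.
have da : is_derive t 1 (fun a : R => c + a *: v) v.
  have cl := clin_scalel v.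
  have : is_derive t 1 (cst c + (fun a : R => a *: v)) (0 + v).
    apply: is_deriveD; split; first exact/diff_derivable/clin_differentiable.
    by rewrite clin_derive // scale1r.
  by rewrite add0r.
have dda : differentiable (fun a : R => c + a *: v) t.
  by apply/derivable1_diffP; case: da.
split; first exact/diff_derivable/(differentiable_comp dda).
rewrite [LHS](@derive_comp _ _ _ _ (fun a : R => c + a *: v) f) //.
by rewrite (@derive_val _ _ _ _ _ _ _ da).
Qed.

(** The second difference is the increment over [[0, h]] of [G t = f (x + h w + t v) - f (x + t v)].
    The mean value theorem turns it into [h] times a difference of two values of [F = 'D_v f] near
    [x], and differentiability of [F] at the point [x] estimates both values. *)
Lemma second_difference V (f : V -> R) (A : set V) x v w (e : R) :
  open A -> A x -> (forall y, A y -> differentiable f y) ->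
  differentiable ('D_v f) x -> 0 < e ->
  exists2 d : R, 0 < d & forall h, 0 < h -> h < d ->
   `| f (x + h *: v + h *: w) - f (x + h *: v) - f (x + h *: w) + f x
      - h ^+ 2 * 'D_w ('D_v f) x | <= e * h ^+ 2.
Proof.
move=> oA Ax df dF e0; set F : V -> R := 'D_v f.
(* [h * M] bounds every displacement from [x] that occurs; the [1] keeps [M] positive when
   [v = w = 0]. The tolerance [e / (2 * M)] lets two remainders add up to [e * h]. *)
pose M := `|v| + `|w| + 1.
have M0 : 0 < M by rewrite ltr_wpDl // addr_ge0.
have e'0 : 0 < e / (2 * M) by rewrite divr_gt0 // mulr_gt0.
have := (eqaddoP _ _ _ _).1 (diff_locally dF) _ e'0.
have nA : \forall y \near 0, A (y + x).
  have : \forall y \near x, A y by exact: open_nbhs_nbhs.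
  by rewrite (near_shift 0) /= subr0.
move=> /(filterI nA) /nbhs_norm0P [rho /= rho0 Hrho].
exists (rho / M); first by rewrite divr_gt0.
move=> h h0; rewrite ltr_pdivlMr // => hrho.
(* The boolean treats the displacements with and without [h *: w] at once. *)
have small (xi : R) (b : bool) : 0 <= xi -> xi <= h ->
    `|xi *: v + (b%:R * h) *: w| <= h * M.
  move=> xi0 xih; apply: (le_trans (ler_normD _ _)); rewrite !normrZ /M.
  rewrite (ger0_norm xi0) ?normrM (gtr0_norm h0) !mulrDr mulr1.
  apply: (@le_trans _ _ (h * `|v| + h * `|w|)); last by rewrite lerDl ltW.
  apply: lerD; first exact: ler_wpM2r.
  apply: ler_wpM2r => //; case: b; rewrite ?normr1 ?normr0 ?mul1r ?mul0r //.
  exact: ltW.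
have est (xi : R) (b : bool) : 0 <= xi -> xi <= h ->
    A (x + xi *: v + (b%:R * h) *: w) /\
    `|F (x + xi *: v + (b%:R * h) *: w) - F x - 'd F x (xi *: v + (b%:R * h) *: w)|
       <= e / (2 * M) * (h * M).
  move=> xi0 xih; have sm := small xi b xi0 xih.
  have [] := Hrho (xi *: v + (b%:R * h) *: w); first exact: le_lt_trans sm hrho.
  rewrite [_ + x]addrC addrA => Ay Fy; split=> //.
  move: Fy; rewrite /= !fctE /= opprD addrA [_ + x]addrC addrA => /le_trans; apply.
  by rewrite ler_wpM2l // ltW.
pose G (t : R) : R := f (x + h *: w + t *: v) - f (x + t *: v).
pose dG (t : R) : R := F (x + h *: w + t *: v) - F (x + t *: v).
have Gd t : 0 <= t -> t <= h -> is_derive t 1 G (dG t).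
  move=> t0 th; apply: is_deriveB; apply: is_derive_along; apply: df.
    by have [+ _] := est t true t0 th; rewrite mul1r addrAC.
  by have [+ _] := est t false t0 th; rewrite mul0r scale0r addr0.
have [||xi] := @MVT _ G dG 0 h h0.
- by move=> t; rewrite in_itv /= => /andP[/ltW t0 /ltW th]; exact: Gd.
- apply: derivable_within_continuous => t; rewrite in_itv /= => /andP[t0 th].
  by case: (Gd t t0 th).
rewrite in_itv /= => /andP[/ltW xi0 /ltW xih]; rewrite subr0 => GE.
have -> : f (x + h *: v + h *: w) - f (x + h *: v) - f (x + h *: w) + f x
      = dG xi * h.
  rewrite -GE /G scale0r !addr0 [x + h *: w + _]addrAC; ring.
have [_ e1] := est xi true xi0 xih; have [_ e2] := est xi false xi0 xih.
have lin2 (s t : R) : 'd F x (s *: v + t *: w) = s * 'd F x v + t * 'd F x w :> R.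
  by rewrite linearD !linearZ.
move: e1 e2; rewrite !lin2 !mul1r !mul0r scale0r !addr0.
rewrite (deriveE _ dF) /dG [x + h *: w + _]addrAC.
set p : R := 'd F x v; set q : R := 'd F x w.
set a : R := F (x + _ + _); set b : R := F (x + _); set c : R := F x.
move=> e1 e2.
(* The terms [xi * p] cancel, which leaves [h] times a difference of two first-order remainders of
   [F]. *)
have -> : (a - b) * h - h ^+ 2 * q =
  h * ((a - c - (xi * p + h * q)) - (b - c - xi * p)) by ring.
rewrite normrM (gtr0_norm h0).
have -> : e * h ^+ 2 = h * (e / (2 * M) * (h * M) + e / (2 * M) * (h * M)).
  by field; rewrite gt_eqF.
rewrite (ler_pM2l h0).
by apply: (le_trans (ler_normB _ _)); exact: lerD.
Qed.

(** The second difference is symmetric in [v] and [w]. Estimating it both ways bounds [h ^+ 2] times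
    the gap between the mixed derivatives by [e * h ^+ 2], for every [e > 0]. *)
Lemma schwarz_real V (f : V -> R) (A : set V) x v w :
  open A -> A x -> differentiable_upto 2 A f ->
  'D_v ('D_w f) x = 'D_w ('D_v f) x.
Proof.
move=> oA Ax [df ddf].
apply/eqP; rewrite -subr_eq0 -normr_le0; apply/ler_addgt0Pr => /= e e0; rewrite add0r.
have e2 : 0 < e / 2 by rewrite divr_gt0.
have [d1 d10 H1] := second_difference w oA Ax df ((ddf v).1 x Ax) e2.
have [d2 d20 H2] := second_difference v oA Ax df ((ddf w).1 x Ax) e2.
pose h := Num.min d1 d2 / 2.
have m0 : 0 < Num.min d1 d2 by rewrite lt_min d10.
have h0 : 0 < h by rewrite divr_gt0.
have hm : h < Num.min d1 d2 by rewrite /h; lra.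
move: hm; rewrite lt_min => /andP[hd1 hd2].
have {}H1 := H1 h h0 hd1; have {}H2 := H2 h h0 hd2.
move: H1 H2; rewrite [x + h *: w + _]addrAC.
move: ('D_w ('D_v f) x) ('D_v ('D_w f) x) => a b.
move: (f _) (f _) (f _) (f _) => s r q p H1 H2.
have h2 : 0 < h ^+ 2 by rewrite exprn_gt0.
rewrite -(ler_pM2r h2) -[X in _ * X](gtr0_norm h2) -normrM.
have -> : (b - a) * h ^+ 2 = (p - q - r + s - h ^+ 2 * a) -
   (p - r - q + s - h ^+ 2 * b) by ring.
apply: (le_trans (ler_normB _ _)).
have -> : e * h ^+ 2 = e / 2 * h ^+ 2 + e / 2 * h ^+ 2 by field.
exact: lerD.
Qed.

Lemma schwarz V W (f : V -> W) (A : set V) x v w :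
  has_coords W -> open A -> A x -> differentiable_upto 2 A f ->
  'D_v ('D_w f) x = 'D_w ('D_v f) x.
Proof.
move=> [N [e [l [cl el]]]] oA Ax sf; have [df ddf] := sf.
have key i : l i ('D_v ('D_w f) x) = l i ('D_w ('D_v f) x).
  have lD u u' : 'D_u ('D_u' (fun z => l i (f z))) x = l i ('D_u ('D_u' f) x).
    rewrite -(derive_clin_comp _ (cl i)); last exact: (ddf u').1.
    apply: (eq_open_derive _ oA Ax) => y Ay.
    by rewrite (derive_clin_comp _ (cl i)) //; exact: df.
  rewrite -!lD; apply: (schwarz_real _ _ oA Ax).
  exact: (differentiable_upto_clin_comp oA (cl i) sf).
by rewrite (el ('D_v _ x)) (el ('D_w _ x)); apply: eq_bigr => i _; rewrite key.
Qed.

End Schwarz.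

(** * Vector fields: derivatives along a field and brackets of related fields *)

Section VectorFields.
Context {R : realType}.
Implicit Types V W : normedModType R.

Lemma derive_linsum V W (f : V -> W) x (I : Type) (s : seq I)
    (c : I -> R) (w : I -> V) : differentiable f x ->
  'D_(\sum_(i <- s) c i *: w i) f x = \sum_(i <- s) c i *: 'D_(w i) f x.
Proof.
move=> df; rewrite deriveE // linear_sum; apply: eq_bigr => i _.
by rewrite linearZ deriveE.
Qed.

Lemma derive_dirB V W (f : V -> W) x a b : differentiable f x ->
  'D_(a - b) f x = 'D_a f x - 'D_b f x.
Proof. by move=> df; rewrite !deriveE // linearB. Qed.

Lemma derive_bigsum V W N (F : 'I_N -> V -> W) x a :
  (forall i, differentiable (F i) x) ->
  'D_a (fun y => \sum_i F i y) x = \sum_i 'D_a (F i) x.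
Proof.
move=> dF; have -> : (fun y => \sum_i F i y) = \sum_i F i.
  by apply/funext => y; rewrite fct_sumE.
by apply: derive_sum => i; exact: diff_derivable.
Qed.

Lemma derive_scale_cst V W (k : R) (f : V -> W) x a : differentiable f x ->
  'D_a (fun y => k *: f y) x = k *: 'D_a f x.
Proof.
move=> df; rewrite (@derive_scale _ _ _ (cst k) f x a (differentiable_cst k x) df).
by rewrite derive_cst scale0r add0r.
Qed.

Lemma derive_along_field V W (A : set V) (w : V -> V) (psi : V -> W) a z :
  has_coords V -> open A -> A z -> smooth_on A psi -> smooth_on A w ->
  'D_a (fun y => 'D_(w y) psi y) z =
  'D_('D_a w z) psi z + 'D_a ('D_(w z) psi) z.
Proof.
move=> [N [e [l [cl el]]]] oA Az sp sw.
have dp y : A y -> differentiable psi y := smooth_on_differentiable sp.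
have dw := smooth_on_differentiable sw Az.
have dde i : differentiable ('D_(e i) psi) z.
  exact: (smooth_on_differentiable (smooth_on_derive (e i) sp) Az).
have dl i : differentiable (fun y => l i (w y)) z by exact: differentiable_clin_comp.
have e1 : 'D_a (fun y => 'D_(w y) psi y) z =
    'D_a (fun y => \sum_i l i (w y) *: 'D_(e i) psi y) z.
  by apply: (eq_open_derive _ oA Az) => y Ay; rewrite (derive_coords (el _) (dp y Ay)).
have e2 : 'D_a ('D_(w z) psi) z = 'D_a (fun y => \sum_i l i (w z) *: 'D_(e i) psi y) z.
  by apply: (eq_open_derive _ oA Az) => y Ay; rewrite (derive_coords (el _) (dp y Ay)).
rewrite e1 derive_bigsum; last by move=> i; exact: differentiable_scale.
rewrite e2 derive_bigsum; last first.
  by move=> i; apply: differentiable_scale => //; exact: differentiable_cst.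
rewrite (derive_coords (el ('D_a w z)) (dp z Az)) -big_split; apply: eq_bigr => i _ /=.
by rewrite derive_scale // derive_scale_cst // (derive_clin_comp _ (cl i)).
Qed.

(* Schwarz's theorem cancels the second derivatives of psi. *)
Lemma bracket_related_fields V W (A : set V) (B : set W) (psi : V -> W)
    (w1 w2 : W -> W) (w1' w2' : V -> V) z :
  has_coords V -> has_coords W -> open A -> A z ->
  (forall y, A y -> B (psi y)) -> smooth_on A psi ->
  smooth_on B w1 -> smooth_on B w2 -> smooth_on A w1' -> smooth_on A w2' ->
  (forall y, A y -> 'D_(w1' y) psi y = w1 (psi y)) ->
  (forall y, A y -> 'D_(w2' y) psi y = w2 (psi y)) ->
  'D_('D_(w1' z) w2' z - 'D_(w2' z) w1' z) psi z =
  'D_(w1 (psi z)) w2 (psi z) - 'D_(w2 (psi z)) w1 (psi z).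
Proof.
move=> hV hW oA Az AB sp s1 s2 s1' s2' r1 r2.
have half (a b : W -> W) (a' b' : V -> V) : smooth_on B b -> smooth_on A b' ->
    (forall y, A y -> 'D_(a' y) psi y = a (psi y)) ->
    (forall y, A y -> 'D_(b' y) psi y = b (psi y)) ->
    'D_('D_(a' z) b' z) psi z =
    'D_(a (psi z)) b (psi z) - 'D_(a' z) ('D_(b' z) psi) z.
  move=> sb sb' ra rb; apply/eqP; rewrite eq_sym subr_eq eq_sym; apply/eqP.
  rewrite -(derive_along_field _ hV oA Az sp sb') (eq_open_derive _ oA Az rb) -(ra z Az).
  apply: (@derive_comp _ _ _ _ psi b); first exact: smooth_on_differentiable sp Az.
  exact: smooth_on_differentiable sb (AB z Az).
rewrite derive_dirB; last exact: smooth_on_differentiable sp Az.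
rewrite (half w1 w2) // (half w2 w1) //.
rewrite (schwarz (w1' z) (w2' z) hW oA Az (sp 2%N)).
by rewrite opprB addrA subrK.
Qed.

Lemma bracket_linsum V N (v : 'I_N -> V -> V) (c c' : 'I_N -> R) z :
  (forall j, differentiable (v j) z) ->
  'D_(\sum_i c i *: v i z) (fun y => \sum_j c' j *: v j y) z -
  'D_(\sum_j c' j *: v j z) (fun y => \sum_i c i *: v i y) z =
  \sum_i \sum_j (c i * c' j) *: ('D_(v i z) (v j) z - 'D_(v j z) (v i) z).
Proof.
move=> dv; have half (a b : 'I_N -> R) :
    'D_(\sum_i a i *: v i z) (fun y => \sum_j b j *: v j y) z =
    \sum_i \sum_j (a i * b j) *: 'D_(v i z) (v j) z.
  rewrite derive_bigsum => [|j]; last exact/differentiable_scale/dv/differentiable_cst.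
  rewrite exchange_big; apply: eq_bigr => j _ /=.
  rewrite derive_scale_cst // derive_linsum // scaler_sumr.
  by apply: eq_bigr => i _; rewrite scalerA mulrC.
rewrite !half [X in _ - X]exchange_big -sumrB /=.
apply: eq_bigr => i _; rewrite -sumrB; apply: eq_bigr => j _.
by rewrite scalerBr [c' j * c i]mulrC.
Qed.

End VectorFields.

(** * Curves and integration by parts *)

Section RealCurves.
Context {R : realType}.
Implicit Types (V W : normedModType R) (A : set R).

Lemma smooth_on_derive1 W A (f : R -> W) : smooth_on A f -> smooth_on A (derive1 f).
Proof.
move=> sf; have -> : derive1 f = 'D_1 f by apply/funext => x; exact: derive1E.
exact: smooth_on_derive.
Qed.

Lemma smooth_on_derive1n W A k (f : R -> W) :
  smooth_on A f -> smooth_on A (derive1n k f).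
Proof.
by move=> sf; elim: k => [//|k IH]; rewrite derive1nS; exact: smooth_on_derive1.
Qed.

Lemma eq_open_derive1 W A (f g : R -> W) x : open A -> A x ->
  (forall y, A y -> f y = g y) -> derive1 f x = derive1 g x.
Proof. by move=> oA Ax fg; rewrite !derive1E; exact: eq_open_derive fg. Qed.

Lemma eq_open_derive1n W A k (f g : R -> W) x : open A -> A x ->
  (forall y, A y -> f y = g y) -> derive1n k f x = derive1n k g x.
Proof.
move=> oA Ax fg; elim: k x Ax => [|k IH] x Ax; first exact: fg.
by rewrite !derive1nS; exact: eq_open_derive1 IH.
Qed.

Lemma smooth_on_derivable W A (f : R -> W) x v : smooth_on A f -> A x -> derivable f x v.
Proof. by move=> sf Ax; apply/diff_derivable/(smooth_on_differentiable sf). Qed.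

Lemma derive1_comp_dir V W (f : R -> V) (g : V -> W) (x : R) (v : V) : is_derive x 1 f v ->
  differentiable g (f x) -> derive1 (g \o f) x = 'D_v g (f x).
Proof.
move=> df dg; rewrite derive1E derive_comp //; first by rewrite derive_val.
by apply/derivable1_diffP; case: df.
Qed.

Lemma smooth_on_ibp A k (f g : R -> R) : open A ->
  smooth_on A f -> smooth_on A g -> smooth_on A (ibp k f g).
Proof.
move=> oA sf sg; apply: smooth_on_sum => // l.
apply: smooth_onM => //; last exact: smooth_on_derive1n.
by apply: smooth_onM => //; [exact: smooth_on_cst|exact: smooth_on_derive1n].
Qed.

Lemma derive1_sum A (I : Type) (s : seq I) (f : I -> R -> R) x : open A -> A x ->
  (forall i, smooth_on A (f i)) ->
  derive1 (fun y => \sum_(i <- s) f i y) x = \sum_(i <- s) derive1 (f i) x.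
Proof.
move=> oA Ax sf; rewrite derive1E.
elim: s => [|i s IH].
  rewrite big_nil; under eq_fun do rewrite big_nil.
  exact: derive_cst.
rewrite big_cons -IH; under eq_fun do rewrite big_cons.
rewrite derive1E; apply: (@deriveD _ _ _ (f i)); first exact: smooth_on_derivable (sf i) Ax.
by apply: smooth_on_derivable Ax; exact: smooth_on_sum.
Qed.

Lemma derive1_cMM (c : R) (f g : R -> R) x : derivable f x 1 -> derivable g x 1 ->
  derive1 (fun y => c * f y * g y) x = c * (f x * derive1 g x + g x * derive1 f x).
Proof.
move=> df dg; have -> : (fun y => c * f y * g y) = (fun y => c * (f * g) y).
  by apply/funext => y; rewrite -mulrA.
rewrite (derive1Ml c (derivableM df dg)) derive1E (deriveM df dg).
by rewrite -!derive1E.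
Qed.

(** With [T l = (-1)^l f^(l) g^(k-l)], the [l]-th summand of [ibp] has derivative [T l - T (l+1)],
    and the sum telescopes to [T 0 - T k]. *)
Lemma derive1_ibp A k (f g : R -> R) s : open A -> A s ->
  smooth_on A f -> smooth_on A g ->
  derive1 (ibp k f g) s =
  f s * derive1n k g s - (-1) ^+ k * derive1n k f s * g s.
Proof.
move=> oA As sf sg.
have sfn l := smooth_on_derive1n l sf; have sgn l := smooth_on_derive1n l sg.
rewrite (@derive1_sum A) //; last first.
  move=> l; apply: smooth_onM => //.
  by apply: smooth_onM => //; exact: smooth_on_cst.
pose T l := (-1) ^+ l * derive1n l f s * derive1n (k - l) g s.
have -> : \sum_(l < k) derive1 (fun x => (-1) ^+ l * derive1n l f x *
      derive1n (k.-1 - l) g x) s = \sum_(l < k) - (T l.+1 - T l).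
  apply: eq_bigr => l _.
  (* The subtractions are truncated; [l < k] makes them exact. *)
  have kl : (k.-1 - l).+1 = (k - l)%N by case: k l {T} => [[]//|k] l; rewrite subSn // -ltnS.
  have kl' : (k.-1 - l = k - l.+1)%N by rewrite subnS -kl.
  have df := smooth_on_derivable (v := 1) (sfn l) As.
  have dg := smooth_on_derivable (v := 1) (sgn (k.-1 - l)%N) As.
  rewrite (derive1_cMM _ df dg) -!derive1nS kl /T -kl' exprS; ring.
rewrite sumrN -(big_mkord predT (fun l => T l.+1 - T l)) telescope_sumr // opprB.
by rewrite /T subn0 subnn expr0 mul1r derive1n0.
Qed.

(** For [f = H_E] and [g = I_tau], the first sum is [sum_j E_kappa j * D_tau kappa^j] by the
    syzygies, and the second is [sum_a E^a(L) I^a_tau]. *)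
Lemma derive1_ibp_sum A (I J K : nat) (f : 'I_I -> 'I_J -> 'I_K -> R -> R)
    (g : 'I_J -> R -> R) s : open A -> A s ->
  (forall j a i, smooth_on A (f j a i)) -> (forall a, smooth_on A (g a)) ->
  derive1 (fun x => \sum_j \sum_a \sum_(i < K) ibp i (f j a i) (g a) x) s =
  \sum_j \sum_a \sum_(i < K) f j a i s * derive1n i (g a) s -
  \sum_a (\sum_j \sum_(i < K) (-1) ^+ i * derive1n i (f j a i) s) * g a s.
Proof.
move=> oA As sf sg.
have s1 j a (i : 'I_K) : smooth_on A (ibp i (f j a i) (g a)) by exact: smooth_on_ibp.
have s2 j a : smooth_on A (fun x => \sum_(i < K) ibp i (f j a i) (g a) x).
  exact: smooth_on_sum.
have s3 j : smooth_on A (fun x => \sum_a \sum_(i < K) ibp i (f j a i) (g a) x).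
  exact: smooth_on_sum.
rewrite (derive1_sum _ oA As s3).
under eq_bigr do rewrite (derive1_sum _ oA As (s2 _)).
under [X in _ - X]eq_bigr do rewrite mulr_suml.
rewrite [X in _ - X]exchange_big -sumrB /=; apply: eq_bigr => j _.
rewrite -sumrB; apply: eq_bigr => a _.
rewrite mulr_suml -sumrB (derive1_sum _ oA As (s1 j a)); apply: eq_bigr => i _.
exact: (derive1_ibp _ oA As (sf j a i) (sg a)).
Qed.

Lemma derive1_eq0_is_cst A (f : R -> R) : is_interval A ->
  (forall x, A x -> differentiable f x /\ derive1 f x = 0) ->
  forall x y, A x -> A y -> f x = f y.
Proof.
move=> iA df x y; wlog xy : x y / x <= y.
  move=> wl Ax Ay; have [/wl|/ltW /wl] := leP x y; first exact.
  by move=> e; rewrite e.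
move=> Ax Ay.
have Az z : x <= z -> z <= y -> A z by move=> xz zy; apply: (iA x y) => //; rewrite xz.
have [||z _] := @MVT_segment _ f (fun=> 0) x y xy.
- move=> z; rewrite in_itv /= => /andP[/ltW xz /ltW zy].
  have [dz z0] := df _ (Az z xz zy).
  by split; [exact: diff_derivable|rewrite -derive1E].
- apply: derivable_within_continuous => z; rewrite in_itv /= => /andP[xz zy].
  by have [dz _] := df _ (Az z xz zy); exact: diff_derivable.
by rewrite mul0r => /eqP; rewrite subr_eq0 => /eqP.
Qed.

End RealCurves.

(** * The infinitesimal action *)

Section LieAction.
Context {R : realType} {q n r : nat} {G : groupType}.
Notation M := (jetSpace R q n).
Context (X : lieGroup R G r) (act : G -> M -> M) (D : set M).
Context (hact : smooth_action X act D) (i0 : nat) (hi0 : dom X i0 1%g).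
Notation v := (infinitesimal X act i0).

Let oD : open D := act_open hact.

Lemma has_coords_jet : has_coords M.
Proof. exact: (has_coords_prod has_coords_real (has_coords_mx _ _)). Qed.

Lemma open_chart i : open (Defs.coord X i @` dom X i).
Proof. by have := @overlap_open _ _ _ X i i; rewrite setIid. Qed.

Lemma open_chart_prod i :
  open [set xz : 'rV[R]_r * M | (Defs.coord X i @` dom X i) xz.1 /\ D xz.2].
Proof.
have -> : [set xz : 'rV[R]_r * M | (Defs.coord X i @` dom X i) xz.1 /\ D xz.2] =
  [set xz | [set xz : 'rV[R]_r * M | setT xz /\ (Defs.coord X i @` dom X i) xz.1] xz
     /\ D xz.2].
  by apply/seteqP; split=> [xz [? ?]|xz [[_ ?] ?]].
apply: open_preimage => //; last exact/smooth_on_clin/clin_snd.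
apply: open_preimage; [exact: openT|exact: open_chart|].
exact/smooth_on_clin/clin_fst.
Qed.

Lemma smooth_on_param_act i :
  smooth_on [set xz : 'rV[R]_r * M | (Defs.coord X i @` dom X i) xz.1 /\ D xz.2]
            (fun xz => act (param X i xz.1) xz.2).
Proof. by case: hact => _ _ _ _; apply. Qed.

(** The action is smooth jointly in chart coordinates and in the point; here the coordinates of [g]
    are frozen. *)
Lemma smooth_on_act g : smooth_on D (act g).
Proof.
have [i ig] := dom_cover X g.
have := @smooth_on_comp R M ('rV[R]_r * M)%type M D _
  (fun z => (Defs.coord X i g, z)) _ _ oD (@open_chart_prod i) _ _ (@smooth_on_param_act i).
rewrite /= (coordK ig); apply.
- exact: (has_coords_prod (has_coords_mx _ _) has_coords_jet).
- by move=> z Dz; split=> //; exists g.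
- by apply: smooth_on_pair; [|exact: smooth_on_cst|apply/smooth_on_clin/clin_id].
Qed.

Lemma infinitesimalE j z :
  v j z = 'D_((delta_mx ord0 j, 0) : 'rV[R]_r * M)
     (fun xz : 'rV[R]_r * M => act (param X i0 xz.1) xz.2) (Defs.coord X i0 1%g, z).
Proof.
exact: (derive_slicel (fun xz : 'rV[R]_r * M => act (param X i0 xz.1) xz.2)).
Qed.

Lemma smooth_on_infinitesimal j : smooth_on D (v j).
Proof.
have -> : v j = fun z => 'D_((delta_mx ord0 j, 0) : 'rV[R]_r * M)
     (fun xz : 'rV[R]_r * M => act (param X i0 xz.1) xz.2) (Defs.coord X i0 1%g, z).
  by apply/funext => z; exact: infinitesimalE.
apply: (@smooth_on_comp R M ('rV[R]_r * M)%type M D _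
  (fun z => (Defs.coord X i0 1%g, z)) _ _ oD (@open_chart_prod i0) _ _
  (smooth_on_derive _ (@smooth_on_param_act i0))).
- exact: (has_coords_prod (has_coords_mx _ _) has_coords_jet).
- by move=> z Dz; split=> //; exists 1%g.
- by apply: smooth_on_pair; [|exact: smooth_on_cst|apply/smooth_on_clin/clin_id].
Qed.

Lemma differentiable_act g z : D z -> differentiable (act g) z.
Proof. exact/smooth_on_differentiable/smooth_on_act. Qed.

Lemma differentiable_infinitesimal j z : D z -> differentiable (v j) z.
Proof. exact/smooth_on_differentiable/smooth_on_infinitesimal. Qed.

Lemma act_invK g z : D z -> act g^-1%g (act g z) = z.
Proof. by move=> Dz; rewrite -(act_mul hact) // mulVg (act_one hact). Qed.

Lemma tangent_actK g z w : D z ->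
  'D_('D_w (act g) z) (act g^-1%g) (act g z) = w.
Proof.
move=> Dz; have Dgz := act_stable hact g Dz.
rewrite -(derive_comp w (differentiable_act g Dz) (differentiable_act g^-1%g Dgz)).
rewrite (eq_open_derive (g := id) w oD Dz); first exact: derive_id.
by move=> y Dy /=; exact: act_invK.
Qed.

Lemma tangent_act_inj g z w1 w2 : D z ->
  'D_w1 (act g) z = 'D_w2 (act g) z -> w1 = w2.
Proof. by move=> Dz e; rewrite -(tangent_actK g w1 Dz) e tangent_actK. Qed.

Lemma bracket_related (psi w1 w2 w1' w2' : M -> M) z : D z ->
  (forall y, D y -> D (psi y)) -> smooth_on D psi ->
  smooth_on D w1 -> smooth_on D w2 -> smooth_on D w1' -> smooth_on D w2' ->
  (forall y, D y -> 'D_(w1' y) psi y = w1 (psi y)) ->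
  (forall y, D y -> 'D_(w2' y) psi y = w2 (psi y)) ->
  'D_(bracket w1' w2' z) psi z = bracket w1 w2 (psi z).
Proof.
move=> Dz Dp sp s1 s2 s1' s2' r1 r2.
exact: (bracket_related_fields has_coords_jet has_coords_jet oD Dz Dp sp
  s1 s2 s1' s2' r1 r2).
Qed.

Lemma eq_bracket (w1 w2 w1' w2' : M -> M) z : D z ->
  (forall y, D y -> w1 y = w1' y) -> (forall y, D y -> w2 y = w2' y) ->
  bracket w1 w2 z = bracket w1' w2' z.
Proof.
move=> Dz e1 e2; rewrite /bracket (e1 z Dz) (e2 z Dz).
by rewrite (eq_open_derive _ oD Dz e1) (eq_open_derive _ oD Dz e2).
Qed.

(** Coefficients are a function, so that a row [A i] of a matrix can be passed as it is. *)
Definition lincomb (c : 'I_r -> R) (z : M) : M := \sum_j c j *: v j z.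

Lemma smooth_on_lincomb c : smooth_on D (lincomb c).
Proof.
apply: smooth_on_sum => // j.
by apply: smooth_onZ => //; [exact: smooth_on_cst|exact: smooth_on_infinitesimal].
Qed.

Lemma bracket_lincomb c c' z : D z ->
  bracket (lincomb c) (lincomb c') z =
  \sum_i \sum_j (c i * c' j) *: bracket (v i) (v j) z.
Proof.
move=> Dz; apply: bracket_linsum => j; exact: differentiable_infinitesimal.
Qed.

End LieAction.

(** * The Killing form *)

Lemma scaler_sum_mul (K : pzRingType) (V : lmodType K) (I J : finType)
    (a : I -> K) (c : I -> J -> K) (w : J -> V) :
  \sum_m (\sum_l a l * c l m) *: w m = \sum_l a l *: \sum_m c l m *: w m.
Proof.
under eq_bigr do rewrite scaler_suml.
rewrite exchange_big; apply: eq_bigr => l _ /=; rewrite scaler_sumr.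
by apply: eq_bigr => m _; rewrite scalerA.
Qed.

Section KillingForm.
Context {R : realType} {q n r : nat} {G : groupType}.
Notation M := (jetSpace R q n).
Context (X : lieGroup R G r) (act : G -> M -> M) (D : set M).
Context (hact : smooth_action X act D) (i0 : nat) (hi0 : dom X i0 1%g).
Notation v := (infinitesimal X act i0).
Notation comb := (lincomb X act i0).
Context (z0 : M) (Dz0 : D z0).
Hypothesis indep : forall c : 'I_r -> R, \sum_j c j *: v j z0 = 0 -> forall j, c j = 0.

Lemma lincomb_inj c c' : comb c z0 = comb c' z0 -> forall j, c j = c' j.
Proof.
move=> e j; apply/eqP; rewrite -subr_eq0; apply/eqP.
apply: (indep (c := fun j => c j - c' j)).
under eq_bigr do rewrite scalerBl.
by rewrite sumrB; apply/eqP; rewrite subr_eq0; apply/eqP.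
Qed.

Lemma lincomb_sum_mul (I : finType) (a : I -> R) (c : I -> 'I_r -> R) z :
  comb (fun m => \sum_l a l * c l m) z = \sum_l a l *: comb (c l) z.
Proof. exact: scaler_sum_mul. Qed.

(** [XG_coord] is a choice with default [0]. The existence of [c] makes it a true coordinate vector,
    and independence at [z0] makes it unique. *)
Lemma XG_coordP w (c : 'rV[R]_r) :
  (forall z, D z -> w z = comb (c ord0) z) -> XG_coord X act D i0 w = c.
Proof.
move=> wc; have /(xgetPex 0) : exists c' : 'rV[R]_r,
    forall z, D z -> w z = \sum_j c' ord0 j *: v j z by exists c.
rewrite -/(XG_coord _ _ _ _ _) => wc'; apply/rowP => j.
by apply: (@lincomb_inj _ (c ord0)); rewrite -wc // [RHS]wc'.
Qed.

Lemma lincomb_delta i z : comb (fun j => (j == i)%:R) z = v i z.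
Proof.
rewrite /lincomb (bigD1 i) //= eqxx scale1r big1 ?addr0 // => j /negbTE ->.
exact: scale0r.
Qed.

Hypothesis hL : lie_algebra_XG X act D i0.

(** Row [k] holds the coordinates of [[v_i, v_k]]. With this row convention [ad v_i \o ad v_j] has
    matrix [ad_mx j *m ad_mx i], in the reverse order. *)
Definition ad_mx i : 'M[R]_r :=
  \matrix_(k, l) XG_coord X act D i0 (bracket (v i) (v k)) ord0 l.

Lemma bracket_ad_mx i k z : D z -> bracket (v i) (v k) z = comb (ad_mx i k) z.
Proof.
have XGv j : XG X act D i0 (v j).
  exists (\row_l (l == j)%:R) => y _; rewrite -[LHS]lincomb_delta.
  by apply: eq_bigr => l _; rewrite mxE.
have [c cE] := hL (XGv i) (XGv k).
move=> Dz; rewrite [LHS]cE //; apply: eq_bigr => l _.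
by rewrite mxE (XG_coordP cE).
Qed.

Lemma bracket_lincomb_ad c c' z : D z ->
  bracket (comb c) (comb c') z =
  comb (fun m => \sum_i \sum_j c i * c' j * ad_mx i j m) z.
Proof.
move=> Dz; rewrite [LHS](bracket_lincomb hact hi0 _ _ Dz).
(* The factor [1] gives the outer sum the shape expected by [lincomb_sum_mul]. *)
have -> : (fun m => \sum_i \sum_j c i * c' j * ad_mx i j m) =
    (fun m => \sum_i 1 * \sum_j c i * c' j * ad_mx i j m).
  by apply/funext => m; under [RHS]eq_bigr do rewrite mul1r.
rewrite [RHS]lincomb_sum_mul; apply: eq_bigr => i _.
rewrite scale1r [RHS]lincomb_sum_mul; apply: eq_bigr => j _.
by rewrite bracket_ad_mx.
Qed.

Lemma killing_mxE i j : killing_mx X act D i0 i j = \tr (ad_mx j *m ad_mx i).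
Proof.
rewrite mxE /killing /XG_trace /mxtrace; apply: eq_bigr => k _ /=.
rewrite (@XG_coordP _ (row k (ad_mx j *m ad_mx i))) ?mxE // => z Dz.
(* The inner bracket agrees with its expansion only on [D]; as [D] is open, this is enough to
   differentiate it. *)
rewrite (eq_bracket hact (w1' := comb (fun l => (l == i)%:R))
  (w2' := comb (ad_mx j k)) Dz); last first.
- by move=> y Dy; exact: bracket_ad_mx.
- by move=> y _; rewrite lincomb_delta.
rewrite bracket_lincomb_ad //; apply: eq_bigr => m _; congr (_ *: _).
rewrite !mxE (bigD1 i) //= [X in _ + X]big1 ?addr0; last first.
  by move=> l /negbTE ->; rewrite big1 // => ? _; rewrite !mul0r.
by apply: eq_bigr => l _; rewrite eqxx mul1r.
Qed.

(** On [D] the field [comb (A i)] is [Ad g (v i)], and [Tg] undoes the [Tg^-1] in it. Being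
    [g]-related to [v i] is the form in which brackets can be transported. *)
Lemma Ad_matrix_related g (A : 'M[R]_r) i z : is_Ad_matrix X act D i0 g A ->
  D z -> 'D_(comb (A i) z) (act g) z = v i (act g z).
Proof.
move=> hA Dz; rewrite -[comb (A i) z](hA i z Dz) /Ad.
have := tangent_actK hact g^-1%g (v i (act g z)) (act_stable hact g Dz).
by rewrite invgK (act_invK hact).
Qed.

(** At [g z0], [A'] expands [Tg (v i z0)] in the [v j], and each [v j (g z0)] is [Tg] of
    [comb (A j) z0]. Injectivity of [Tg] and independence at [z0] conclude. *)
Lemma Ad_matrixV g (A A' : 'M[R]_r) : is_Ad_matrix X act D i0 g A ->
  is_Ad_matrix X act D i0 g^-1%g A' -> A' *m A = 1%:M.
Proof.
move=> hA hA'; apply/matrixP => i k.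
have Dgz := act_stable hact g Dz0.
have := hA' i (act g z0) Dgz.
rewrite /Ad invgK (act_invK hact) // => e.
rewrite !mxE -mulr_natr mul1r eq_sym.
apply: (@lincomb_inj (fun k => \sum_j A' i j * A j k) (fun k => (k == i)%:R)).
rewrite lincomb_delta; apply: (tangent_act_inj hact (g := g) Dz0).
rewrite [RHS]e [comb _ z0]lincomb_sum_mul.
rewrite derive_linsum; last exact: (differentiable_act hact g Dz0).
by apply: eq_bigr => j _; rewrite (Ad_matrix_related _ hA).
Qed.

(** The matrix form of [[Ad v_i, Ad v_k] = Ad [v_i, v_k]], with [k] as row index: both sides have
    the same image under [Tg], because brackets of related fields are related. *)
Lemma Ad_matrix_ad g (A : 'M[R]_r) i : is_Ad_matrix X act D i0 g A ->
  A *m (\sum_p A i p *: ad_mx p) = ad_mx i *m A.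
Proof.
move=> hA; apply/matrixP => k m.
have e : bracket (comb (A i)) (comb (A k)) z0 =
    comb (fun m => \sum_l ad_mx i k l * A l m) z0.
  apply: (tangent_act_inj hact (g := g) Dz0).
  rewrite (bracket_related hact Dz0 (act_stable hact g) (smooth_on_act hact g)
    (smooth_on_infinitesimal hact hi0 i) (smooth_on_infinitesimal hact hi0 k)
    (smooth_on_lincomb hact hi0 (A i)) (smooth_on_lincomb hact hi0 (A k))
    (fun y Dy => Ad_matrix_related i hA Dy) (fun y Dy => Ad_matrix_related k hA Dy)).
  rewrite bracket_ad_mx; last exact: (act_stable hact g Dz0).
  rewrite [X in 'D_X _ _]lincomb_sum_mul.
  rewrite derive_linsum; last exact: (differentiable_act hact g Dz0).
  by apply: eq_bigr => l _; rewrite (Ad_matrix_related l hA).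
rewrite bracket_lincomb_ad // in e.
have {}e := lincomb_inj e m; rewrite !mxE -e exchange_big /=.
apply: eq_bigr => j _; rewrite summxE mulr_sumr; apply: eq_bigr => p _.
by rewrite !mxE mulrA [A k j * _]mulrC.
Qed.

(** [N i] is the matrix of [ad (Ad v_i)], conjugate to [ad_mx i] by [A], so traces of products
    agree. Bilinear expansion of the trace of [N j *m N i] gives the entry of [A B A^T]. *)
Lemma killing_mx_Ad g (A : 'M[R]_r) : is_Ad_matrix X act D i0 g A ->
  A \in unitmx -> A *m killing_mx X act D i0 *m A^T = killing_mx X act D i0.
Proof.
move=> hA uA; apply/matrixP => i j; rewrite [RHS]killing_mxE.
pose N i := \sum_p A i p *: ad_mx p.
have NE k : N k = invmx A *m ad_mx k *m A.
  by rewrite -mulmxA -(Ad_matrix_ad k hA) mulKmx.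
have -> : \tr (ad_mx j *m ad_mx i) = \tr (N j *m N i).
  by rewrite !NE !mulmxA mulmxK // [RHS]mxtrace_mulC !mulmxA mulmxV // mul1mx.
rewrite /N mulmx_suml raddf_sum mxE; apply: eq_bigr => p _ /=.
rewrite mulmx_sumr raddf_sum !mxE mulr_suml; apply: eq_bigr => l _ /=.
by rewrite -scalemxAl -scalemxAr !mxtraceZ killing_mxE mulrC mulrA.
Qed.

Lemma killing_inv_Ad g (A : 'M[R]_r) (x : 'cV[R]_r) : is_Ad_matrix X act D i0 g A ->
  A \in unitmx -> killing_mx X act D i0 \in unitmx ->
  let B := killing_mx X act D i0 in
  (invmx A *m x)^T *m invmx B *m (invmx A *m x) = x^T *m invmx B *m x.
Proof.
move=> hA uA uB B; have AB : A *m B *m A^T = B by exact: killing_mx_Ad hA uA.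
have uAT : A^T \in unitmx by rewrite unitmx_tr.
have e : (invmx A)^T *m invmx B *m invmx A = invmx B.
  have : (A *m B *m A^T) *m ((invmx A)^T *m invmx B *m invmx A) = 1%:M.
    rewrite trmx_inv -!mulmxA (mulKVmx uAT) (mulKVmx (_ : B \in unitmx)) //.
    exact: mulmxV uA.
  by rewrite AB => BC; rewrite -[LHS](mulKmx (_ : B \in unitmx)) // BC mulmx1.
by rewrite -[in RHS]e trmx_mul !mulmxA.
Qed.

End KillingForm.

(** * The moving frame *)

Section Frame.
Context {R : realType} {q n r : nat} {G : groupType}.
Notation M := (jetSpace R q n).
Context (X : lieGroup R G r) (act : G -> M -> M) (D : set M).
Context (hact : smooth_action X act D) (i0 : nat).
Context (U K : set M) (rho : M -> G).
Context (hframe : right_moving_frame X act D i0 U K rho).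

Let oD : open D := act_open hact.
Let oU : open U := dom_open (frame_regular hframe).
Let UD : U `<=` D := dom_sub (frame_regular hframe).

(** Both points lie in [K] and on the orbit of [z], which meet only once. *)
Lemma invariantise_act g z : U z -> U (act g z) ->
  invariantise act rho (act g z) = invariantise act rho z.
Proof.
move=> Uz Ugz; have [k [_ kP]] := section_meets (frame_regular hframe) Uz.
transitivity k; [apply/esym|]; apply: kP; split.
- by exists (rho (act g z) * g)%g => //; rewrite (act_mul hact) //; exact: UD.
- exact: frame_section hframe _ Ugz.
- by exists (rho z).
- exact: frame_section hframe _ Uz.
Qed.

(** The argument of the frame and the point acted on are kept apart, because [I_tauJ] differentiates
    the second with the first frozen. The diagonal gives [invariantise]. *)
Lemma smooth_on_frame_act :
  smooth_on [set zw : M * M | U zw.1 /\ D zw.2] (fun zw => act (rho zw.1) zw.2).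
Proof.
apply: local_smooth_on => -[z w] /= [Uz Dw].
have [i [N [oN Nz domN sN]]] := frame_smooth hframe Uz.
pose B := [set zw : M * M | [set zw : M * M | setT zw /\ N zw.1] zw /\ D zw.2].
have oB1 : open [set zw : M * M | setT zw /\ N zw.1].
  by apply: open_preimage => //; [exact: openT|exact/smooth_on_clin/clin_fst].
have oB : open B by apply: open_preimage => //; exact/smooth_on_clin/clin_snd.
exists B; split => //.
have hM := has_coords_jet (R := R) (q := q) (n := n).
have hP := has_coords_prod (has_coords_mx (R := R) 1 r) hM.
have s1 : smooth_on B (fun zw => Defs.coord X i (rho zw.1)).
  apply: (smooth_on_comp hM oB oN _ _ sN); first by move=> zw [[_ ?] _].
  exact/smooth_on_clin/clin_fst.
have s2 := smooth_on_pair oB s1 (smooth_on_clin B (@clin_snd R M M)).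
have := smooth_on_comp hP oB (@open_chart_prod _ _ _ _ _ _ _ _ hact i) _ s2
  (@smooth_on_param_act _ _ _ _ _ _ _ _ hact i).
have BP x : B x -> [set xz : 'rV[R]_r * M | (Defs.coord X i @` dom X i) xz.1 /\
    D xz.2] (Defs.coord X i (rho x.1), x.2).
  by case=> -[_ Nx] Dx; split=> //; exists (rho x.1) => //; exact: domN.
move=> /(_ BP); apply: eq_smooth_on => // zw [[_ Nzw] _] /=.
by rewrite (coordK (domN _ Nzw)).
Qed.

Lemma open_frame_act : open [set zw : M * M | U zw.1 /\ D zw.2].
Proof.
have -> : [set zw : M * M | U zw.1 /\ D zw.2] =
    [set zw | [set zw : M * M | setT zw /\ U zw.1] zw /\ D zw.2].
  by apply/seteqP; split=> [xz [? ?]|xz [[_ ?] ?]].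
apply: open_preimage => //; last exact/smooth_on_clin/clin_snd.
by apply: open_preimage => //; [exact: openT|exact/smooth_on_clin/clin_fst].
Qed.

Lemma smooth_on_invariantise : smooth_on U (invariantise act rho).
Proof.
have hM := has_coords_jet (R := R) (q := q) (n := n).
have sid := smooth_on_clin U (@clin_id R M).
apply: (smooth_on_comp (has_coords_prod hM hM) oU open_frame_act _
  (smooth_on_pair oU sid sid) smooth_on_frame_act).
by move=> z Uz; split=> //; exact: UD.
Qed.

Lemma smooth_on_jet (A : set R) (u : R -> 'cV[R]_q) : open A -> smooth_on A u ->
  smooth_on A (jet u : R -> M).
Proof.
move=> oA su; apply: smooth_on_pair => //; first exact/smooth_on_clin/clin_id.
apply: smooth_on_mx => // i j.
have := smooth_on_derive1n j (smooth_on_entry i ord0 oA su).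
by apply: eq_smooth_on => // s _; rewrite mxE.
Qed.

Lemma eq_jet (A : set R) (u w : R -> 'cV[R]_q) s : open A -> A s ->
  (forall t, A t -> u t = w t) -> jet u s = jet w s :> M.
Proof.
move=> oA As uw; congr pair; apply/matrixP => i j; rewrite !mxE.
by apply: eq_open_derive1n oA As _ => t At; rewrite uw.
Qed.

Context {p : nat} (gen : 'I_p -> 'I_q * 'I_n.+1).

Lemma smooth_on_kappa j : smooth_on U (kappa act rho gen j).
Proof.
apply: smooth_on_entry => //.
exact: (smooth_on_clin_comp oU (@clin_snd R R 'M[R]_(q, n.+1)) smooth_on_invariantise).
Qed.

Lemma kappa_act j g z : U z -> U (act g z) ->
  kappa act rho gen j (act g z) = kappa act rho gen j z.
Proof. by move=> Uz Ugz; rewrite /kappa invariantise_act. Qed.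

Lemma smooth_on_kappa_jet m A u : curve_in U A u ->
  smooth_on A (kappa_jet act rho gen m u).
Proof.
move=> [oA su Uu]; apply: smooth_on_mx => // j k.
have hM := has_coords_jet (R := R) (q := q) (n := n).
have := smooth_on_derive1n k
  (smooth_on_comp hM oA oU Uu (smooth_on_jet oA su) (smooth_on_kappa j)).
by apply: eq_smooth_on => // s _; rewrite mxE.
Qed.

Context {m d : nat} (L : 'M[R]_(p, m.+1) -> R).
Context (h : 'I_p -> 'I_q -> 'I_d -> 'M[R]_(p, m.+1) -> R).
Context (V : set 'M[R]_(p, m.+1)) (hV : smooth_coefficients act U rho gen L h V).

Lemma smooth_on_dL j k A u : curve_in U A u -> smooth_on A (dL act rho gen L j k u).
Proof.
move=> uU; have [oV Vu sL _] := hV; have [oA _ _] := uU.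
exact: (smooth_on_comp (has_coords_mx _ _) oA oV (Vu A u uU)
  (smooth_on_kappa_jet m uU) (smooth_on_derive (delta_mx j k) sL)).
Qed.

Lemma smooth_on_H_E j a i A u : curve_in U A u ->
  smooth_on A (H_E act rho gen L h j a i u).
Proof.
move=> uU; have [oV Vu _ sh] := hV; have [oA _ _] := uU.
apply: smooth_onM => //.
  exact: (smooth_on_comp (has_coords_mx _ _) oA oV (Vu A u uU)
    (smooth_on_kappa_jet m uU) (sh j a i)).
apply: smooth_on_sum => // k; apply: smooth_onM => //; first exact: smooth_on_cst.
exact/smooth_on_derive1n/smooth_on_dL.
Qed.

End Frame.

(** * The group variation *)

Section GroupVariation.
Context {R : realType} {q n r : nat} {G : groupType}.
Notation M := (jetSpace R q n).
Context (X : lieGroup R G r) (act : G -> M -> M) (D : set M).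
Context (hact : smooth_action X act D) (hprol : prolonged act D).
Context (i0 : nat) (hi0 : dom X i0 1%g).
Context (U K : set M) (rho : M -> G).
Context (hframe : right_moving_frame X act D i0 U K rho).
Context (A : set R) (u : R -> 'cV[R]_q) (uU : curve_in U A u) (j : 'I_r).
Notation v := (infinitesimal X act i0).

Let oD : open D := act_open hact.
Let oU : open U := dom_open (frame_regular hframe).
Let UD : U `<=` D := dom_sub (frame_regular hframe).
Let oA : open A. Proof. by case: uU. Qed.
Let uA s : A s -> U (jet u s). Proof. by case: uU => _ _; exact. Qed.

Definition group_line (tau : R) : 'rV[R]_r :=
  Defs.coord X i0 1%g + tau *: delta_mx ord0 j.

(* Off A the value u s is chosen so that the slice at tau = 0 is u itself. *)
Definition group_variation (x : R * R) : 'cV[R]_q :=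
  if `[< A x.1 >] then order0 (act (param X i0 (group_line x.2)) (jet u x.1))
  else u x.1.

Definition variation_dom0 : set (R * R) :=
  [set x | A x.1 /\ (Defs.coord X i0 @` dom X i0) (group_line x.2)].

(** The condition on [U] is what [variation_in] demands of every slice; it also keeps the moved jets
    where [kappa] is invariant. *)
Definition variation_dom : set (R * R) :=
  [set x | variation_dom0 x /\ U (act (param X i0 (group_line x.2)) (jet u x.1))].

Lemma group_line0 : param X i0 (group_line 0) = 1%g.
Proof. by rewrite /group_line scale0r addr0 coordK. Qed.

Lemma smooth_on_group_line (B : set (R * R)) : open B ->
  smooth_on B (fun x => group_line x.2).
Proof.
move=> oB; apply: smooth_onD => //; first exact: smooth_on_cst.
apply: smooth_onZ => //; last exact: smooth_on_cst.
exact/smooth_on_clin/clin_snd.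
Qed.

Lemma open_variation_dom0 : open variation_dom0.
Proof.
have o1 : open [set x : R * R | setT x /\ A x.1].
  by apply: open_preimage => //; [exact: openT|exact/smooth_on_clin/clin_fst].
have -> : variation_dom0 = [set x : R * R | [set x : R * R | setT x /\ A x.1] x /\
    (Defs.coord X i0 @` dom X i0) (group_line x.2)].
  by apply/seteqP; split=> [x [? ?]|x [[_ ?] ?]].
apply: open_preimage => //; first exact: open_chart.
exact: smooth_on_group_line.
Qed.

Lemma smooth_on_moved_jet :
  smooth_on variation_dom0 (fun x => act (param X i0 (group_line x.2)) (jet u x.1)).
Proof.
have oW := open_variation_dom0.
have hM := has_coords_jet (R := R) (q := q) (n := n).
have [_ su _] := uU.
have s1 : smooth_on variation_dom0 (fun x => jet u x.1 : M).
  apply: (smooth_on_comp has_coords_real oW oA _ _ (smooth_on_jet oA su)).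
    by move=> x [].
  exact/smooth_on_clin/clin_fst.
apply: (smooth_on_comp (has_coords_prod (has_coords_mx _ _) hM) oW
  (@open_chart_prod _ _ _ _ _ _ _ _ hact i0) _
  (smooth_on_pair oW (smooth_on_group_line oW) s1)
  (@smooth_on_param_act _ _ _ _ _ _ _ _ hact i0)).
by move=> x [Ax cx]; split=> //=; exact/UD/uA.
Qed.

Lemma open_variation_dom : open variation_dom.
Proof. exact: open_preimage open_variation_dom0 oU smooth_on_moved_jet. Qed.

Lemma variation_dom_s0 s : A s -> variation_dom (s, 0).
Proof.
move=> As; split; last by rewrite /= group_line0 (act_one hact); [exact: uA|exact/UD/uA].
by split=> //; exists 1%g => //; rewrite /group_line /= scale0r addr0.
Qed.

(** The variation only records the order 0 part of the moved jets; that its own jets are the moved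
    ones is the prolongation property. *)
Lemma jet_group_variation s tau : A s ->
  jet (slice group_variation tau) s = act (param X i0 (group_line tau)) (jet u s).
Proof.
move=> As; have uD : curve_in D A u.
  by have [? ? uU'] := uU; split=> // t At; exact/UD/uU'.
rewrite (act_prolonged hprol _ uD) //; apply: (eq_jet oA As) => t At.
by rewrite /slice /group_variation asboolT.
Qed.

Lemma slice_group_variation0 : slice group_variation 0 = u.
Proof.
apply/funext => s; rewrite /slice /group_variation; case: asboolP => //= As.
rewrite group_line0 (act_one hact); last exact/UD/uA.
by apply/colP => a; rewrite !mxE.
Qed.

Lemma group_variation_in : variation_in U variation_dom group_variation.
Proof.
split; first exact: open_variation_dom.
  have sub : variation_dom `<=` variation_dom0 by move=> x [].
  have sW := sub_smooth_on sub smooth_on_moved_jet.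
  have oW := open_variation_dom.
  apply: smooth_on_mx => // a b.
  have := smooth_on_entry a ord0 oW
    (smooth_on_clin_comp oW (@clin_snd R R 'M[R]_(q, n.+1)) sW).
  apply: eq_smooth_on => // x [[Ax _] _].
  by rewrite /group_variation asboolT // mxE; congr (_ _ _).
by move=> s tau [[As _] UW]; rewrite jet_group_variation.
Qed.

Lemma open_variation_times s : open [set tau | variation_dom (s, tau)].
Proof.
have := @open_preimage R R (R * R)%type setT variation_dom (fun tau => (s, tau)) openT
  open_variation_dom.
have -> : [set x | setT x /\ variation_dom (s, x)] = [set tau | variation_dom (s, tau)].
  by apply/seteqP; split=> [x []|x].
apply; apply: smooth_on_pair; [exact: openT|exact: smooth_on_cst|].
exact/smooth_on_clin/clin_id.
Qed.

(** [kappa] is constant in [tau] while the moved jet stays in [U], hence on an open set of times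
    containing [0]. *)
Lemma D_tau_kappa_group_variation p (gen : 'I_p -> 'I_q * 'I_n.+1) i s : A s ->
  D_tau_kappa act rho gen group_variation i s 0 = 0.
Proof.
move=> As; rewrite /D_tau_kappa.
rewrite (eq_open_derive1 (g := cst (kappa act rho gen i (jet u s)))
  (@open_variation_times s) (variation_dom_s0 As)); first exact: derive1_cst.
move=> tau [_ UW]; rewrite jet_group_variation //=.
by apply: (kappa_act hact hframe) => //; exact: uA.
Qed.

Lemma is_derive_param_act z : D z ->
  is_derive (0 : R) 1 (fun tau => act (param X i0 (group_line tau)) z) (v j z).
Proof.
move=> Dz.
have df : differentiable (fun a => act (param X i0 a) z) (group_line 0).
  have := @smooth_on_differentiable _ _ _ _ _ (Defs.coord X i0 1%g, z)
    (@smooth_on_param_act _ _ _ _ _ _ _ _ hact i0).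
  rewrite /= /group_line scale0r addr0 => /(_ _) df.
  have {}df := df (conj (ex_intro2 _ _ 1%g hi0 erefl) Dz).
  apply: (@differentiable_comp _ _ _ _ (fun a => (a, z))) df.
  apply: differentiable_pair => //; exact: differentiable_cst.
have := is_derive_along df.
by rewrite scale0r addr0.
Qed.

Lemma I_tauJ_group_variation s : A s ->
  I_tauJ act rho group_variation s 0 =
  ('D_(v j (jet u s)) (act (rho (jet u s))) (jet u s)).2.
Proof.
move=> As; have Dz : D (jet u s) by exact/UD/uA.
rewrite /I_tauJ slice_group_variation0.
set g := rho _; set z := jet u s.
pose F tau := act (param X i0 (group_line tau)) z.
have -> : (fun t => act g (jet (slice group_variation t) s)) = act g \o F.
  by apply/funext => t; rewrite jet_group_variation.
have F0 : F 0 = z by rewrite /F group_line0 (act_one hact).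
have dg : differentiable (act g) (F 0) by rewrite F0; exact: (differentiable_act hact).
have e : derive1 (act g \o F) 0 = 'D_(v j z) (act g) (F 0).
  exact: (derive1_comp_dir (is_derive_param_act Dz) dg).
by rewrite F0 in e; exact: (congr1 snd e).
Qed.

Lemma smooth_on_I_tau_group_variation a :
  smooth_on A (fun s => I_tau act rho group_variation a s 0).
Proof.
have hM := has_coords_jet (R := R) (q := q) (n := n).
have [_ su _] := uU.
have sj := smooth_on_jet (n := n) oA su.
have UDA s : A s -> [set zw : M * M | U zw.1 /\ D zw.2] (jet u s, jet u s).
  by move=> As; split; [exact: uA|exact/UD/uA].
have sv : smooth_on A (fun s => v j (jet u s)).
  by apply: (smooth_on_comp hM oA oD _ sj (smooth_on_infinitesimal hact hi0 j)) => s /uA/UD.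
(* The component [0] freezes the frame: only the point acted on is differentiated. *)
have s0 : smooth_on A (fun s => (0 : M, v j (jet u s))).
  by apply: smooth_on_pair => //; exact: smooth_on_cst.
have s1 := smooth_on_dir_derive (has_coords_prod hM hM) oA (open_frame_act hact hframe)
  UDA (smooth_on_pair oA sj sj) s0 (smooth_on_frame_act hact hframe).
have := smooth_on_entry a ord0 oA
  (smooth_on_clin_comp oA (@clin_snd R R 'M[R]_(q, n.+1)) s1).
apply: (eq_smooth_on oA) => s As.
have e := derive_slicer (fun zw : M * M => act (rho zw.1) zw.2) (jet u s) (jet u s)
  (v j (jet u s)).
by rewrite -e /I_tau (I_tauJ_group_variation As).
Qed.

Context {p : nat} (gen : 'I_p -> 'I_q * 'I_n.+1) {m d : nat}.
Context (L : 'M[R]_(p, m.+1) -> R) (h : 'I_p -> 'I_q -> 'I_d -> 'M[R]_(p, m.+1) -> R).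
Context (V : set 'M[R]_(p, m.+1)) (hV : smooth_coefficients act U rho gen L h V).
Context (hsyz : syzygies act U rho gen h).

Lemma P_boundary_group_variation : is_interval A ->
  (forall a s, A s -> euler_lagrange act rho gen L h a u s = 0) ->
  forall s t, A s -> A t ->
  P_boundary act rho gen L h group_variation s 0 =
  P_boundary act rho gen L h group_variation t 0.
Proof.
move=> iA EL.
pose I a s := I_tau act rho group_variation a s 0.
pose Q s := \sum_i \sum_a \sum_(k < d) ibp k (H_E act rho gen L h i a k u) (I a) s.
(* [D_tau kappa] vanishes on the whole open set [A], so its [s]-derivatives vanish too, and the
   first family of boundary terms drops out. *)
have PQ s : A s -> P_boundary act rho gen L h group_variation s 0 = Q s.
  move=> As; rewrite /P_boundary slice_group_variation0 big1 ?add0r // => i _.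
  rewrite big1 // => k _; rewrite /ibp big1 // => l _.
  rewrite [X in _ * X](eq_open_derive1n _ (g := cst 0) oA As) => [|x Ax]; last first.
    exact: D_tau_kappa_group_variation.
  have -> : derive1n (k.-1 - l) (cst (0 : R)) = cst 0.
    elim: (k.-1 - l)%N => [//|e IH]; rewrite derive1nS IH.
    by apply/funext => x; rewrite derive1_cst.
  by rewrite mulr0.
have sI a : smooth_on A (I a) := smooth_on_I_tau_group_variation a.
have sH i a k := smooth_on_H_E hact hframe hV i a k uU.
have sQ : smooth_on A Q.
  do 3 (apply: smooth_on_sum => // ?); exact: smooth_on_ibp.
move=> s t As At; rewrite !PQ //; apply: (derive1_eq0_is_cst iA _ As At) => x Ax.
split; first exact: smooth_on_differentiable sQ Ax.
rewrite (derive1_ibp_sum oA Ax sH sI) [X in _ - X]big1 ?subr0; last first.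
  by move=> a _; rewrite (_ : \sum_i _ = 0) ?mul0r //; exact: EL.
apply: big1 => i _.
(* The left side of this syzygy is [0]; multiplied by [E_kappa i], its right side is the sum that
   has to vanish. *)
have := hsyz group_variation_in (variation_dom_s0 Ax) i.
rewrite D_tau_kappa_group_variation // slice_group_variation0.
move=> /(congr1 (fun y => E_kappa act rho gen L i u x * y)); rewrite mulr0 mulr_sumr => e.
apply/esym/(etrans e); apply: eq_bigr => a _; rewrite mulr_sumr; apply: eq_bigr => k _.
by rewrite /H_E mulrA [X in X * _]mulrC.
Qed.

Context (C : 'I_q -> M -> 'cV[R]_n.+1) (hC : boundary_coefficients act U rho gen L h C).
Context (B : 'M[R]_r).

Lemma P_boundary_upsilon s : A s ->
  is_Ad_matrix X act D i0 (rho (jet u s))^-1%g B ->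
  P_boundary act rho gen L h group_variation s 0 =
  (B *m upsilon X act i0 rho C (jet u s)) j ord0.
Proof.
move=> As hB; have [_ _ PE] := hC.
rewrite (PE _ _ group_variation_in _ _ (variation_dom_s0 As)) slice_group_variation0.
set z := jet u s; set g := rho z.
have Dz : D z by exact/UD/uA.
have := hB j (act g z) (act_stable hact g Dz).
rewrite /Ad invgK (act_invK hact) // => e.
rewrite I_tauJ_group_variation // -/z -/g e.
rewrite mxE [RHS](eq_bigr (fun l => \sum_a \sum_k
   B j l * (v l (invariantise act rho z)).2 a k * C a z k ord0)); last first.
  move=> l _; rewrite summxE mulr_sumr; apply: eq_bigr => a _.
  rewrite mxE mulr_sumr; apply: eq_bigr => k _.
  by rewrite mxE mulrA.
(* With the sum over [l] innermost, one recognises the components of [Tg (v j z)], expanded at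
   [I(z)] with coefficients [B j l]. *)
rewrite [RHS]exchange_big; apply: eq_bigr => a _; rewrite [RHS]exchange_big.
apply: eq_bigr => k _; rewrite -mulr_suml; congr (_ * _).
rewrite (clin_sum _ _ _ (@clin_snd R R 'M[R]_(q, n.+1))) summxE.
by apply: eq_bigr => l _; rewrite mxE.
Qed.

End GroupVariation.

(** * Noether's first integrals and their Killing quadratic form *)

Theorem theorem4p1 (R : realType) (q n r : nat)
  (G : groupType) (X : lieGroup R G r)
  (act : G -> jetSpace R q n -> jetSpace R q n) (D : set (jetSpace R q n))
  (hact : smooth_action X act D) (hprol : prolonged act D)
  (i0 : nat) (hi0 : dom X i0 1%g)
  (U K : set (jetSpace R q n)) (rho : jetSpace R q n -> G)
  (hframe : right_moving_frame X act D i0 U K rho)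
  (hss : semisimple_XG X act D i0)
  (AdM : G -> 'M[R]_r) (hAd : forall g, is_Ad_matrix X act D i0 g (AdM g))
  (p : nat) (gen : 'I_p -> 'I_q * 'I_n.+1)
  (hgen : generating act U rho gen)
  (m d : nat) (L : 'M[R]_(p, m.+1) -> R)
  (h : 'I_p -> 'I_q -> 'I_d -> 'M[R]_(p, m.+1) -> R)
  (V : set 'M[R]_(p, m.+1))
  (hV : smooth_coefficients act U rho gen L h V)
  (hsyz : syzygies act U rho gen h)
  (C : 'I_q -> jetSpace R q n -> 'cV[R]_n.+1)
  (hC : boundary_coefficients act U rho gen L h C) :
  let B := killing_mx X act D i0 in
  let ups := upsilon X act i0 rho C in
  first_integral act U rho gen L h
    (fun z => (ups z)^T *m invmx B *m ups z) /\
  (forall A u, solution act U rho gen L h A u ->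
   exists c : 'cV[R]_r, forall s, A s ->
     invmx (AdM (rho (jet u s))) *m ups (jet u s) = c /\
     (ups (jet u s))^T *m invmx B *m ups (jet u s) = c^T *m invmx B *m c).
Proof.
move=> B ups; have [hL uB] := hss.
have noether A u : solution act U rho gen L h A u ->
    exists c : 'cV[R]_r, forall s, A s ->
      invmx (AdM (rho (jet u s))) *m ups (jet u s) = c /\
      (ups (jet u s))^T *m invmx B *m ups (jet u s) = c^T *m invmx B *m c.
  (* The constants are the boundary terms at some [s0] in [A]; on an empty interval any vector will
     do. *)
  move=> [iA uU EL]; case: (pselect (exists s, A s)) => [[s0 As0]|noA]; last first.
    by exists 0 => s As; case: noA; exists s.
  pose P s : 'cV[R]_r := \col_j
    P_boundary act rho gen L h (group_variation X act i0 A u j) s 0.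
  exists (P s0) => s As; have [_ _ uA] := uU.
  have Uz := uA s As; have Dz := dom_sub (frame_regular hframe) Uz.
  (* The current jet serves as the base point [z0] of the Killing form computations. *)
  have indep (c : 'I_r -> R) := @orbit_dim _ _ _ _ _ _ _ _ _ _ _
    (frame_regular hframe) _ c Uz.
  set g := rho (jet u s).
  have AdV : AdM g^-1%g *m AdM g = 1%:M.
    exact: (Ad_matrixV hact Dz indep (hAd g) (hAd g^-1%g)).
  have uAd : AdM g \in unitmx by case: (mulmx1_unit AdV).
  have cE : invmx (AdM g) *m ups (jet u s) = P s0.
    (* The inverse in Noether's integrals is the matrix of [Ad] at [g^-1], the one that expands
       [Tg (v j z)]. *)
    have -> : invmx (AdM g) = AdM g^-1%g by rewrite -[RHS](mulmxK uAd) AdV mul1mx.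
    apply/colP => j; rewrite [RHS]mxE.
    rewrite (P_boundary_group_variation hact hprol hi0 hframe uU j hV hsyz iA EL As0 As).
    exact/esym/(P_boundary_upsilon hact hprol hi0 hframe uU j hC As (hAd _)).
  split=> //; rewrite -cE.
  by rewrite (killing_inv_Ad hact hi0 Dz indep hL _ (hAd g) uAd uB).
split=> // A u sol; have [c cE] := noether A u sol.
by exists (c^T *m invmx B *m c) => s As; case: (cE s As).
Qed.
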